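(* Let $k$ be a field, $n\ge 2$, and let $\prec$ be the term order $\mathrm{RevLex}$ on $k[x,y,z_1,\dots,z_{n-1}]$ with $x\succ y\succ z_1\succ\dots\succ z_{n-1}$. For a positive integer $\mu$ let $r$ and $t$ be the only integers such that $1\le t\le r+1$ and $\mu=\frac{(r+2)(r+1)}{2}-t$, and consider the ideal of $k[x,y,z_1,\dots,z_{n-1}]$ $$\mathcal{R}(\mu,n)=(x^r,\dots,x^{r-i}y^{i+\delta_i},\dots,y^{r+\delta_r}),$$ generated by the monomials $x^{r-i}y^{i+\delta_i}$ for $0\le i\le r$, where $\delta_i=0$ if $i<t$ and $\delta_i=1$ otherwise. Then the homogeneous stratum $\mathcal{S}t_h(\mathcal{R}(\mu,n),\mathrm{RevLex})$ is isomorphic to an affine space $\mathbb{A}^N$ over $k$ of dimension $$N=N(n,\mu)=2(n-1)\mu+t(r+1-t)\binom{n-2}{2}.$$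
   Context: $\mathrm{RevLex}$ is the degree reverse lexicographic order. $\binom{m}{2}=0$ for $m=0,1$. Homogeneous strata. Write $X$ for the variables of the polynomial ring. Put $\mathrm{htail}(X^\alpha)=\{X^\beta: X^\beta\prec X^\alpha,\ |\beta|=|\alpha|\}$. Let $J$ be a monomial ideal with minimal monomial generators $X^{\alpha_1},\dots,X^{\alpha_m}$. Put $T_i=\mathrm{htail}(X^{\alpha_i})\setminus J$, introduce a set $C$ of new variables $c_{i\beta}$, one for each $i$ and each $X^\beta\in T_i$, and set $F_i=X^{\alpha_i}+\sum_{X^\beta\in T_i}c_{i\beta}X^\beta$, with leading monomial $X^{\alpha_i}$ (as a polynomial in $X$ with coefficients in $k[C]$). For $i<j$ let $H_{ij}$ be a complete reduction of the $S$-polynomial of $F_i,F_j$ with respect to $\{F_1,\dots,F_m\}$ (division in the variables $X$ with coefficients in $k[C]$, so that no monomial in $X$ appearing in $H_{ij}$ lies in $J$). The homogeneous stratum $\mathcal{S}t_h(J,\prec)$ is the closed subscheme of the affine space $\mathbb{A}^{|C|}$ over $k$ defined by the ideal of $k[C]$ generated by all coefficients in $k[C]$ of the monomials in $X$ of all the $H_{ij}$ (this ideal is independent of the choice of reductions). *)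

(* Defs.v *)
From mathcomp Require Import all_boot all_order all_algebra.
From mathcomp Require Export mpoly.
From Stdlib Require Import Relations.

Set Implicit Arguments.
Unset Strict Implicit.
Unset Printing Implicit Defensive.

Import GRing.Theory.
Local Open Scope ring_scope.

(* The closed subscheme of the affine space of dimension [ambient_dim] over k
   cut out by the ideal that [equations] generates. *)
Record affine_scheme (k : fieldType) := AffineScheme {
  ambient_dim : nat;
  equations : {mpoly k[ambient_dim]} -> Prop }.

Definition in_ideal (R : nzRingType) (S : R -> Prop) (p : R) : Prop :=
  exists2 s : seq (R * R), (forall q, q \in s -> S q.2)
    & p = \sum_(q <- s) q.1 * q.2.

Definition defining_ideal (k : fieldType) (V : affine_scheme k) :=
  in_ideal (@equations k V).

Definition affine_space (k : fieldType) (N : nat) : affine_scheme k :=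
  @AffineScheme k N (fun=> False).

(* An isomorphism of affine k-schemes is an isomorphism of the coordinate
   k-algebras k[V]/I(V) and k[W]/I(W); f and g represent two mutually inverse
   k-algebra morphisms between these quotients. *)
Definition isomorphic (k : fieldType) (V W : affine_scheme k) : Prop :=
  exists (f : {lrmorphism {mpoly k[ambient_dim V]} -> {mpoly k[ambient_dim W]}})
         (g : {lrmorphism {mpoly k[ambient_dim W]} -> {mpoly k[ambient_dim V]}}),
  [/\ forall p, defining_ideal p -> defining_ideal (f p),
      forall q, defining_ideal q -> defining_ideal (g q),
      forall p, defining_ideal (g (f p) - p)
    & forall q, defining_ideal (f (g q) - q)].

(* Strict degree reverse lexicographic order with 'X_0 > 'X_1 > ...
   (The order that mpoly.v puts on monomials compares the first exponents that
   differ, so it is the degree lexicographic order and cannot be used here.) *)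
Definition revlex (v : nat) : rel 'X_{1..v} := fun b a =>
  (mdeg b < mdeg a)%N ||
  (mdeg b == mdeg a) &&
  [exists i : 'I_v, (a i < b i)%N &&
     [forall j : 'I_v, (i < j)%N ==> (a j == b j)]].

Section Stratum.

Variables (k : fieldType) (v : nat) (prec : rel 'X_{1..v}).

(* A monomial ideal is given by a sequence G of exponents of monomials that
   generate it. *)
Variable G : seq 'X_{1..v}.

Definition in_monideal (b : 'X_{1..v}) : bool := has (fun a => (a <= b)%MM) G.

Definition mingens : seq 'X_{1..v} :=
  undup [seq a <- G | all (fun b => (b <= a)%MM ==> (b == a)) G].

Definition gen_index := 'I_(size mingens).

Definition mingen (i : gen_index) : 'X_{1..v} := tnth (in_tuple mingens) i.

Definition htail (a : 'X_{1..v}) : pred 'X_{1..v} :=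
  [pred b | prec b a & mdeg b == mdeg a].

Definition tail (i : gen_index) : pred 'X_{1..v} :=
  [pred b | htail (mingen i) b & ~~ in_monideal b].

(* The bound on the degree only serves to make the set of pairs (i, b) with
   b in [tail i] a finite type. *)
Definition deg_bound : nat := (\max_(a <- mingens) mdeg a).+1.

Definition coef_index :=
  {c : gen_index * 'X_{1..v < deg_bound} | tail c.1 (bmnm c.2)}.

Definition nparam : nat := #|{: coef_index}|.

Definition marked_family (i : gen_index) : {mpoly {mpoly k[nparam]}[v]} :=
  'X_[mingen i] +
  \sum_(c : coef_index | (val c).1 == i) 'X_(enum_rank c) *: 'X_[bmnm (val c).2].

(* The leading coefficient of every [marked_family i] is 1, so no division in
   the coefficient ring occurs in an S-polynomial or in a reduction step. *)
Definition Spoly (i j : gen_index) : {mpoly {mpoly k[nparam]}[v]} :=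
  let m := mlcm (mingen i) (mingen j) in
  'X_[m - mingen i] * marked_family i - 'X_[m - mingen j] * marked_family j.

Definition red_step (f g : {mpoly {mpoly k[nparam]}[v]}) : Prop :=
  exists (l : gen_index) (c : 'X_{1..v}),
    let a := f@_(c + mingen l) in
    a != 0 /\ g = f - a *: 'X_[c] * marked_family l.

Definition complete_reduction (f h : {mpoly {mpoly k[nparam]}[v]}) : Prop :=
  clos_refl_trans _ red_step f h /\
  forall b, b \in msupp h -> ~~ in_monideal b.

Definition Spoly_reductions
    (H : gen_index -> gen_index -> {mpoly {mpoly k[nparam]}[v]}) : Prop :=
  forall i j : gen_index, (i < j)%N -> complete_reduction (Spoly i j) (H i j).

Definition homogeneous_stratum
    (H : gen_index -> gen_index -> {mpoly {mpoly k[nparam]}[v]}) :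
    affine_scheme k :=
  @AffineScheme k nparam (fun p => exists (i j : gen_index) (b : 'X_{1..v}),
    (i < j)%N /\ p = (H i j)@_b).

End Stratum.

(* Exponents of x ^ (r - i) * y ^ (i + delta_i), 0 <= i <= r, in the n + 1
   variables x, y, z_1, ..., z_(n-1), numbered from 0 in this order. *)
Definition Rgens (n r t : nat) : seq 'X_{1..n.+1} :=
  [seq [multinom (if val l == 0 then r - i
                  else if val l == 1 then i + (t <= i)
                  else 0)%N | l < n.+1]
  | i <- iota 0 r.+1].

(* Main.v *)
From HB Require Import structures.
From Stdlib Require Import Relations ClassicalEpsilon.
Require Import Defs.
From mathcomp Require Import all_boot all_order all_algebra.
From mathcomp Require Import ssrcomplements mpoly zify ring.

Set Implicit Arguments.
Unset Strict Implicit.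
Unset Printing Implicit Defensive.

(** Write [x, y] for the first two variables and [z] for the others.  The
    ideal [J] contains [lead j = x ^ stair j * y ^ j] for [0 <= j <= r.+1], and
    its generators are those with [j != t], as [lead t = y * lead t.-1].
    A marked family [F] is a point of the stratum iff its extension [H] by an
    entry for [lead t] satisfies relations
      [y H_i = x H_(i+1) + sum_j B_ij H_j]  (without [x H_(i+1)] if [i.+1 = t])
    for [0 <= i <= r], whose coefficients [B_ij] only involve the [z]'s.  By
    homogeneity [B_ij] has degree at most 2; all its coefficients are free,
    except that the rows [i < t] are partly determined by the others and by the
    free coefficients of [x ^ (r - j) * y ^ j] in the [H_i].
    Conversely any such matrix has a unique marked solution [H], given by its
    maximal minors (Hilbert-Burch).  Hence the stratum is the affine space
    of the free parameters. *)

Import GRing.Theory.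
Local Open Scope ring_scope.

(** * Monomials split as a z-part times x^a y^b *)

(** Eliminating among the equations of the stratum is avoided. Existence and uniqueness of solutions
    hold over every nonzero commutative ring, so they apply to the ring of parameters and to the
    coordinate ring of the stratum, which is not known beforehand to be reduced. One composite of
    the two morphisms is then the identity of the polynomial ring, the other is the identity modulo
    the ideal. The redundant entry [lead t] is added because consecutive leading monomials then
    differ by exchanging [x] for [y], except at [t.-1], where [y * lead t.-1 = lead t]. All
    relations have [y] on the diagonal, and modulo the z's what remains is strictly triangular. The
    price is that the minimal generators only give the S-polynomial of [lead t.-1] and [lead t.+1],
    from which the relation of row [t] must be recovered. Origin of the dimension: with
    [s = r + 1 - t] and [n - 1] variables z there are [(t - 1) t + s (s + 1)] free linear forms,
    [t s] free quadrics with [binom(n, 2)] coefficients each, and [t s] free coefficients at z-free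
    monomials. *)

Section Monomials.

Variable q : nat.

Definition ix : 'I_q.+2 := ord0.
Definition iy : 'I_q.+2 := Ordinal (isT : (1 < q.+2)%N).

Definition zmon (m : 'X_{1..q.+2}) := (m ix == 0%N) && (m iy == 0%N).

Definition zpart (m : 'X_{1..q.+2}) : 'X_{1..q.+2} :=
  [multinom (if (i < 2)%N then 0%N else m i) | i < q.+2].

Definition mono (z : 'X_{1..q.+2}) (a b : nat) : 'X_{1..q.+2} :=
  (z + (U_(ix) *+ a + U_(iy) *+ b))%MM.

Lemma ixP (i : 'I_q.+2) : [\/ i = ix, i = iy | (2 <= i)%N].
Proof.
case: i => [[|[|i]] hi]; [apply: Or31|apply: Or32|exact: Or33]; exact: val_inj.
Qed.

Lemma ge2_ix (i : 'I_q.+2) : (2 <= i)%N -> (ix == i) = false.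
Proof. by move=> hi; apply/eqP => e; rewrite -e in hi. Qed.

Lemma ge2_iy (i : 'I_q.+2) : (2 <= i)%N -> (iy == i) = false.
Proof. by move=> hi; apply/eqP => e; rewrite -e in hi. Qed.

Lemma monoE z a b i : mono z a b i = (z i + ((ix == i) * a + (iy == i) * b))%N.
Proof. by rewrite !mnmDE !mulmnE !mnm1E. Qed.

Lemma mono_x z a b : zmon z -> mono z a b ix = a.
Proof. by case/andP => /eqP zx _; rewrite monoE zx eqxx /=; lia. Qed.

Lemma mono_y z a b : zmon z -> mono z a b iy = b.
Proof. by case/andP => _ /eqP zy; rewrite monoE zy eqxx /=; lia. Qed.

Lemma zmon_zpart m : zmon (zpart m).
Proof. by rewrite /zmon !mnmE. Qed.

Lemma zmon0 : zmon 0%MM.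
Proof. by rewrite /zmon !mnm0E. Qed.

Lemma zmonD z z' : zmon (z + z')%MM = zmon z && zmon z'.
Proof. by rewrite /zmon !mnmDE !addn_eq0; case: eqP; case: eqP; case: eqP; case: eqP. Qed.

Lemma zmonB z g : zmon z -> zmon (z - g)%MM.
Proof. by rewrite /zmon !mnmBE => /andP[/eqP -> /eqP ->]; rewrite !sub0n. Qed.

Lemma zpart_mono z a b : zmon z -> zpart (mono z a b) = z.
Proof.
case/andP => /eqP zx /eqP zy; apply/mnmP => i; rewrite mnmE.
case: (ixP i) => [->|->|hi]; rewrite ?zx ?zy //.
rewrite ltnNge hi /= monoE.
rewrite ge2_ix // ge2_iy //.
by rewrite addn0.
Qed.

Lemma monoK m : mono (zpart m) (m ix) (m iy) = m.
Proof.
apply/mnmP => i; rewrite monoE mnmE.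
case: (ixP i) => [->|->|hi]; rewrite ?eqxx /=; [lia|lia|].
rewrite ltnNge hi /=.
rewrite ge2_ix // ge2_iy //.
by rewrite addn0.
Qed.

Lemma mdeg_mono z a b : mdeg (mono z a b) = (mdeg z + (a + b))%N.
Proof. by rewrite !mdegD !mdegMn !mdeg1; lia. Qed.

Lemma mono_eq z a b z' a' b' : zmon z -> zmon z' ->
  (mono z a b == mono z' a' b') = [&& z == z', a == a' & b == b'].
Proof.
move=> hz hz'; apply/eqP/and3P => [e|[/eqP-> /eqP-> /eqP->]//].
have := congr1 zpart e; have := congr1 (fun m => fun_of_multinom m ix) e.
have := congr1 (fun m => fun_of_multinom m iy) e.
by rewrite !zpart_mono // !mono_x // !mono_y // => -> -> ->.
Qed.

Lemma monoD z g a b : mono (z + g) a b = (g + mono z a b)%MM.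
Proof. by rewrite /mono [(z + g)%MM]addmC -addmA. Qed.

Lemma mono00 z : mono z 0 0 = z.
Proof. by rewrite /mono !mulm0n !addm0. Qed.

Lemma mono_Sx z a b : mono z a.+1 b = (U_(ix) + mono z a b)%MM.
Proof. by apply/mnmP => i; rewrite mnmDE !monoE mnm1E; lia. Qed.

Lemma mono_Sy z a b : mono z a b.+1 = (U_(iy) + mono z a b)%MM.
Proof. by apply/mnmP => i; rewrite mnmDE !monoE mnm1E; lia. Qed.

Lemma mono_le g z a b : zmon g -> zmon z ->
  (g <= mono z a b)%MM = (g <= z)%MM.
Proof.
move=> /andP[/eqP gx /eqP gy] hz; apply/mnm_lepP/mnm_lepP => h i; last first.
  by rewrite monoE; move: (h i); lia.
move: (h i); rewrite monoE; case: (ixP i) => [->|->|hi]; rewrite ?gx ?gy //.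
rewrite ge2_ix // ge2_iy //.
by rewrite addn0.
Qed.

Lemma mono_sub g z a b : (g <= z)%MM -> (mono z a b - g)%MM = mono (z - g) a b.
Proof. by move=> h; rewrite -{1}(submK h) monoD addmC addmK. Qed.

(** * Coefficients of products with a monomial *)

Section Coefficients.

Variable K : comNzRingType.
Implicit Types (p : {mpoly K[q.+2]}) (z g : 'X_{1..q.+2}).

Lemma mcoeffXM p (c m : 'X_{1..q.+2}) :
  ('X_[c] * p)@_m = if (c <= m)%MM then p@_(m - c) else 0.
Proof.
rewrite mulrC; case: ifP => h; first by rewrite -{1}(submK h) addmC mcoeffMX.
apply: memN_msupp_eq0; rewrite (perm_mem (msuppMX _ _)); apply/mapP => -[m' _ e].
by rewrite e lem_addr in h.
Qed.

Lemma mcoeffXMD p (c m : 'X_{1..q.+2}) : ('X_[c] * p)@_(c + m) = p@_m.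
Proof. by rewrite mcoeffXM lem_addr addmC addmK. Qed.

Lemma mcoeff_xM p z a b : zmon z ->
  ('X_ix * p)@_(mono z a b) = if a is a'.+1 then p@_(mono z a' b) else 0.
Proof.
case: a => [|a] hz; last by rewrite mono_Sx mcoeffXMD.
by rewrite mcoeffXM lep1mP mono_x.
Qed.

Lemma mcoeff_yM p z a b : zmon z ->
  ('X_iy * p)@_(mono z a b) = if b is b'.+1 then p@_(mono z a b') else 0.
Proof.
case: b => [|b] hz; last by rewrite mono_Sy mcoeffXMD.
by rewrite mcoeffXM lep1mP mono_y.
Qed.

Lemma mcoeff_zM p g z a b : zmon g -> zmon z ->
  ('X_[g] * p)@_(mono z a b) =
  if (g <= z)%MM then p@_(mono (z - g) a b) else 0.
Proof.
by move=> hg hz; rewrite mcoeffXM mono_le //; case: ifP => // h; rewrite mono_sub.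
Qed.

Lemma mono_polyP p p' :
  (forall z a b, zmon z -> p@_(mono z a b) = p'@_(mono z a b)) -> p = p'.
Proof. by move=> h; apply/mpolyP => m; rewrite -(monoK m) h ?zmon_zpart. Qed.

End Coefficients.

End Monomials.

(** * Marked families and their syzygies *)

Section Staircase.

Variables q r t : nat.
Hypothesis ht : (0 < t <= r.+1)%N.

(* The least [a] such that [x ^ a * y ^ b] lies in the ideal. *)
Definition stair b := (if b < t then r - b else r.+1 - b)%N.

Definition rowdeg j := if (j < t)%N then r else r.+1.

Definition inJ (m : 'X_{1..q.+2}) := (stair (m (iy q)) <= m (ix q))%N.

Definition lead j : 'X_{1..q.+2} := mono 0 (stair j) j.

(* Positions [(i, j, z)] of the coefficients of the syzygy matrix that are
   parameters. *)
Definition free_index i j (z : 'X_{1..q.+2}) :=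
  [&& (i <= r)%N, (j <= r.+1)%N, i.+1 != t, (i < t)%N ==> (j < t)%N, zmon z
    & (mdeg z + rowdeg j == (rowdeg i).+1)%N].

Section Families.

Variable K : comNzRingType.
Local Notation S := {mpoly K[q.+2]}.
Implicit Types (H : nat -> S) (mx e : nat -> nat -> 'X_{1..q.+2} -> K)
  (c : nat -> nat -> K).

(** The term order does not appear: [tailE] shows that every monomial of the right degree outside
    the ideal lies below the leading one, so homogeneity and reducedness say everything. *)
Definition markedj H j := forall z a b, zmon z ->
  ((mdeg z + a + b != rowdeg j)%N -> (H j)@_(mono z a b) = 0) /\
  ((stair b <= a)%N ->
     (H j)@_(mono z a b) = [&& z == 0%MM, a == stair j & b == j]%:R).

Definition marked H := forall j, (j <= r.+1)%N -> markedj H j.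

Definition syz H i : S :=
  'X_(iy q) * H i - ('X_(ix q) * H i.+1) *+ (i.+1 != t).

(** When [syz H i] is a combination of the [H j] with coefficients in the z's, the monomial
    [z * lead j] can only come from [z * H j], so this is the coefficient of [z] in the entry
    [(i, j)] of the matrix. *)
Definition syzcoef H i j z : K := (syz H i)@_(mono z (stair j) j).

Definition topcoef H i j : K := (H i)@_(mono 0 (r - j) j).

(* The bound 3 is harmless, as the entries have degree at most 2. *)
Definition zpoly (f : 'X_{1..q.+2} -> K) : S :=
  \sum_(g : 'X_{1..q.+2 < 3}) f (bmnm g) *: 'X_[bmnm g].

Definition syzrel mx H := forall i, (i <= r)%N ->
  syz H i = \sum_(j < r.+2) zpoly (mx i j) * H j.

(* Solves [d i.+1 m = d i m.-1 - e i m] (with [d i (-1) = 0]), the recursion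
   satisfied by the coefficients [d i m] of the [H_i] at
   [z * x ^ (r - m.+1) * y ^ m]. *)
Fixpoint telescope (e : nat -> nat -> K) m i : K :=
  (if m is m'.+1 then telescope e m' i.-1 else 0) - e i.-1 m.

(** The coefficient of [x ^ (r - j) * y ^ j] in row [i < t]: reducedness fixes it for [j < t]. The
    value 0 for [j > r] stands for a monomial that does not exist, since [r - j] is truncated. *)
Definition toprow c i j : K :=
  if (j < t)%N then (i == j)%:R else if (j <= r)%N then c i j else 0.

(* The syzygy matrix with free coefficients [e], and [c] at the monomials
   [x ^ (r - j) * y ^ j].  The entries with [i < t <= j] are constants read off
   at [z = 0]; those with [i.+1 = t] and [j < t] are forced by the requirement
   that [H_t] be reduced. *)
Definition syzmx c e i j z : K :=
  if ~~ (zmon z && (mdeg z + rowdeg j == (rowdeg i).+1)%N) then 0 else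
  if (i < t)%N then
    if (t <= j)%N then toprow c i j.-1 - toprow c i.+1 j *+ (i.+1 != t)
    else if i.+1 == t then
      if j is j'.+1 then telescope (fun i m => e i m z) j' i else 0
    else e i j z
  else e i j z.

Lemma mcoeff_syz H i z a b : zmon z ->
  (syz H i)@_(mono z a b) =
  (if b is b'.+1 then (H i)@_(mono z a b') else 0)
  - (if a is a'.+1 then (H i.+1)@_(mono z a' b) else 0) *+ (i.+1 != t).
Proof. by move=> hz; rewrite mcoeffB mcoeffMn mcoeff_xM // mcoeff_yM. Qed.

Lemma rowdegS i : i.+1 != t -> rowdeg i.+1 = rowdeg i.
Proof. by rewrite /rowdeg; case: (ltnP i t); case: (ltnP i.+1 t); lia. Qed.

Lemma stairD j : (j <= r.+1)%N -> (stair j + j = rowdeg j)%N.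
Proof. by rewrite /rowdeg /stair; case: (ltnP j t); lia. Qed.

Lemma syz_homog H i : (i <= r)%N -> marked H ->
  forall z a b, zmon z -> (mdeg z + a + b != (rowdeg i).+1)%N ->
  (syz H i)@_(mono z a b) = 0.
Proof.
move=> hi hH z a b hz hd; rewrite mcoeff_syz //.
have -> : (if b is b'.+1 then (H i)@_(mono z a b') else 0) = 0.
  by case: b hd => // b hd; apply: (proj1 (hH i _ z a b hz)); lia.
case: eqP => [_|hit]; rewrite ?mulr0n ?subr0 // mulr1n.
case: a hd => [|a] hd; rewrite ?subr0 //.
rewrite (proj1 (hH i.+1 _ z a b hz)) ?subr0 //.
by rewrite rowdegS; [lia|apply/eqP].
Qed.

Lemma toprow_topcoef H i j : marked H -> (i < t)%N ->
  (j <= r)%N -> (H i)@_(mono 0 (r - j) j) = toprow (topcoef H) i j.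
Proof.
move=> hH hi hj; rewrite /toprow; case: ltnP => hjt; last by rewrite hj.
rewrite (proj2 (hH i _ _ _ _ (zmon0 q))) ?eqxx /=; try lia.
  by congr (_%:R); rewrite /stair hi; lia.
by rewrite /stair hjt.
Qed.

Lemma telescopeE H z m i : marked H -> zmon z -> mdeg z = 1%N ->
  (m < i < t)%N ->
  (H i)@_(mono z (r - m.+1) m) = telescope (fun i m => syzcoef H i m z) m i.
Proof.
move=> hH hz hd; elim: m i => [|m IH] [|i] // hmi.
  rewrite /= sub0r /syzcoef mcoeff_syz // sub0r.
  have -> : i.+1 != t by lia.
  rewrite mulr1n opprK /stair.
  have -> : (0 < t)%N by lia.
  by have -> : (r - 0 = (r - 1).+1)%N by lia.
rewrite /= -IH; last by lia.
rewrite /syzcoef mcoeff_syz //.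
have -> : i.+1 != t by lia.
rewrite mulr1n /stair.
have -> : (m.+1 < t)%N by lia.
have -> : (r - m.+1 = (r - m.+2).+1)%N by lia.
by rewrite opprB addrC addrNK.
Qed.

(** The dependent entries are computed from the free data. Those of degree zero compare z-free
    coefficients of two consecutive rows. Row [t.-1] has no term [x H_t], so its entries in columns
    below [t] are coefficients of [H_(t-1)] itself, which the relations of the preceding rows
    telescope. *)
Lemma syzcoefE H i j z : marked H -> (i <= r)%N -> (j <= r.+1)%N -> zmon z ->
  syzcoef H i j z = syzmx (topcoef H) (syzcoef H) i j z.
Proof.
move=> hH hi hj hz; rewrite /syzmx hz /=.
case: eqP => /= hd; last first.
  rewrite /syzcoef (syz_homog hi hH) //.
  by rewrite -addnA stairD //; apply/eqP.
case: ltnP => hit //.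
have hri : rowdeg i = r by rewrite /rowdeg hit.
case: leqP => hjt.
  have z0 : z = 0%MM.
    by apply/eqP; rewrite -mdeg_eq0; move: hd; rewrite hri /rowdeg ltnNge hjt /=; lia.
  rewrite {1}/syzcoef mcoeff_syz // z0 /stair ltnNge hjt /=.
  case: j hj hjt {hd} => [|j] hj hjt; first by lia.
  rewrite subSS /= toprow_topcoef //; congr (_ - _).
  case: eqP => hit'; rewrite ?mulr0n ?mulr1n //.
  case: (leqP j.+1 r) => hjr.
    have -> : (r - j = (r - j.+1).+1)%N by lia.
    by rewrite toprow_topcoef //; lia.
  have -> : (r - j = 0)%N by lia.
  rewrite /toprow; have -> : (j.+1 < t)%N = false by lia.
  by have -> : (j < r)%N = false by lia.
have hrj : rowdeg j = r by rewrite /rowdeg hjt.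
case: eqP => hit' //.
rewrite {1}/syzcoef mcoeff_syz // hit' eqxx mulr0n subr0.
case: j hj hjt hrj hd => [|j] hj hjt hrj hd //.
rewrite /stair hjt telescopeE //; first by move: hd; rewrite hri hrj; lia.
by lia.
Qed.

Lemma mcoeff_zpoly f (z : 'X_{1..q.+2}) : (mdeg z < 3)%N -> (zpoly f)@_z = f z.
Proof. by move=> hz; rewrite /zpoly mcoeff_mpoly. Qed.

Lemma mcoeff_zpoly_ge f (z : 'X_{1..q.+2}) : (3 <= mdeg z)%N -> (zpoly f)@_z = 0.
Proof.
move=> hz; rewrite /zpoly raddf_sum big1 // => g _ /=.
rewrite mcoeffZ mcoeffX; case: eqP => [e|]; last by rewrite mulr0.
by have := bmdeg g; rewrite e ltnNge hz.
Qed.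

Lemma syzmx_zmon c e i j z : ~~ zmon z -> syzmx c e i j z = 0.
Proof. by rewrite /syzmx => /negbTE ->. Qed.

Lemma syzmx_deg c e i j z : (mdeg z + rowdeg j != (rowdeg i).+1)%N ->
  syzmx c e i j z = 0.
Proof. by rewrite /syzmx => /negbTE ->; rewrite andbF. Qed.

Lemma mcoeff_zpolyM f (p : S) z a b :
  (forall g, ~~ zmon g -> f g = 0) -> zmon z ->
  (zpoly f * p)@_(mono z a b) =
  \sum_(g : 'X_{1..q.+2 < 3} | (bmnm g <= z)%MM)
    f (bmnm g) * p@_(mono (z - g) a b).
Proof.
move=> hf hz; rewrite /zpoly mulr_suml raddf_sum [RHS]big_mkcond /=.
apply: eq_bigr => g _; rewrite -scalerAl mcoeffZ.
case: (boolP (zmon (bmnm g))) => hg; last by rewrite (hf _ hg) !mul0r if_same.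
by rewrite mcoeff_zM //; case: ifP => // _; rewrite mulr0.
Qed.

(** An entry of degree zero needs [rowdeg j = (rowdeg i).+1], that is, a jump across [t]. Hence the
    matrix is strictly upper triangular modulo the z's. *)
Lemma syzmx_const c e i j : (i <= r)%N -> syzmx c e i j 0 != 0 -> (i < t <= j)%N.
Proof.
move=> hi; rewrite /syzmx zmon0 mdeg0 add0n /= /rowdeg.
case: (ltnP i t) => hit; case: (ltnP j t) => hjt; rewrite ?eqxx //=.
- by rewrite (_ : (r == r.+1) = false) ?eqxx //; lia.
- by rewrite (_ : (r == r.+2) = false) ?eqxx //; lia.
by rewrite (_ : (r.+1 == r.+2) = false) ?eqxx //; lia.
Qed.

(** The relation of row [t.-1] thus reads [y H_(t-1) = H_t + ...] and determines the redundant entry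
    from the others. *)
Lemma syzmx_pivot c e : syzmx c e t.-1 t 0 = 1.
Proof.
rewrite /syzmx zmon0 mdeg0 add0n /= /rowdeg leqnn ltnn.
have -> : (t.-1 < t)%N by lia.
rewrite eqxx /= prednK ?eqxx ?mulr0n ?subr0; last by lia.
by rewrite /toprow eqxx; have -> : (t.-1 < t)%N by lia.
Qed.

(** Solved for the [y]-term, the relation serves as a recursion in both directions: on the exponent
    of [y] with increasing rows, and on the rows downwards. *)
Lemma syzrel_coef c e H i z a b : syzrel (syzmx c e) H -> (i <= r)%N -> zmon z ->
  (if b is b'.+1 then (H i)@_(mono z a b') else 0) =
  (if a is a'.+1 then (H i.+1)@_(mono z a' b) else 0) *+ (i.+1 != t) +
  \sum_(j < r.+2) \sum_(g : 'X_{1..q.+2 < 3} | (bmnm g <= z)%MM)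
    syzmx c e i j g * (H j)@_(mono (z - g) a b).
Proof.
move=> hH hi hz; have := congr1 (mcoeff (mono z a b)) (hH i hi).
rewrite mcoeff_syz // raddf_sum /= => /(canRL (subrK _)) ->; rewrite addrC.
congr (_ + _); apply: eq_bigr => j _; apply: mcoeff_zpolyM => // g.
exact: syzmx_zmon.
Qed.

End Families.
End Staircase.

(** * A solution is determined by its syzygy matrix *)

Section Uniqueness.

Variables q r t : nat.
Hypothesis ht : (0 < t <= r.+1)%N.
Variable K : comNzRingType.
Local Notation S := {mpoly K[q.+2]}.
Local Notation syzmx := (@syzmx q r t K).
Implicit Types (H W : nat -> S) (e : nat -> nat -> 'X_{1..q.+2} -> K)
  (c : nat -> nat -> K).

Lemma syzrelB mx H H' : syzrel r t mx H -> syzrel r t mx H' ->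
  syzrel r t mx (fun j => H j - H' j).
Proof.
move=> hH hH' i hi; have := hH i hi; have := hH' i hi.
rewrite /syz !mulrBr mulrnBl => e' e.
rewrite opprB addrACA [X in _ + X]addrC -opprB -[X in _ - X]opprB opprK.
under eq_bigr do rewrite mulrBr.
rewrite sumrB -e -e'; ring.
Qed.

(** A term of an entry with positive z-degree multiplies a coefficient of smaller z-degree, which
    vanishes; only the constant part of the matrix acts on the lowest part. *)
Lemma syzrel_lowest c e W z : syzrel r t (syzmx c e) W -> zmon z ->
  (forall z' j a b, zmon z' -> (mdeg z' < mdeg z)%N -> (j <= r.+1)%N ->
     (W j)@_(mono z' a b) = 0) ->
  forall i a b, (i <= r)%N ->
  (if b is b'.+1 then (W i)@_(mono z a b') else 0) =
  (if a is a'.+1 then (W i.+1)@_(mono z a' b) else 0) *+ (i.+1 != t) +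
  \sum_(j < r.+2) syzmx c e i j 0 * (W j)@_(mono z a b).
Proof.
move=> hW hz IH i a b hi; rewrite (syzrel_coef a b hW hi hz); congr (_ + _).
apply: eq_bigr => j _; rewrite (bigD1 bm0) /=; last by apply/mnm_lepP => ?; rewrite mnm0E.
rewrite subm0 big1 ?addr0 // => g /andP[hg g0].
case: (boolP (zmon (bmnm g))) => hgz; last by rewrite syzmx_zmon // mul0r.
rewrite (IH _ _ _ _ (zmonB _ hz)) ?mulr0 //; last by rewrite -ltnS.
have : mdeg (bmnm g) != 0%N by rewrite mdeg_eq0.
by have := mdegD (z - bmnm g)%MM (bmnm g); rewrite submK //; lia.
Qed.

(* The lowest part of a difference of two solutions is a multiple of the
   vector of leading parts of a solution, so its entry [j] is divisible by
   [y ^ j]; the degree of the last entry leaves no room for [y ^ r.+1]. *)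
Lemma syzrel_eq0 c e W : syzrel r t (syzmx c e) W ->
  (forall j a b, (j <= r.+1)%N -> (W j)@_(mono 0 a b) = 0) ->
  (forall z a b, zmon z -> (mdeg z + a + b != r.+1)%N ->
     (W r.+1)@_(mono z a b) = 0) ->
  forall j, (j <= r.+1)%N -> W j = 0.
Proof.
move=> hW hW0 hWr j hj; apply: mono_polyP => z a b hz; rewrite mcoeff0.
have [d hd] := ubnP (mdeg z); elim: d z hz hd j a b hj => // d IHd z hz hd.
have R : forall i a b, (i <= r)%N ->
  (if b is b'.+1 then (W i)@_(mono z a b') else 0) =
  (if a is a'.+1 then (W i.+1)@_(mono z a' b) else 0) *+ (i.+1 != t) +
  \sum_(j < r.+2) syzmx c e i j 0 * (W j)@_(mono z a b).
  apply: syzrel_lowest => // z' j a b hz' hlt hj.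
  by apply: IHd => //; apply: leq_trans hlt _.
have sum0 (i a b : nat) : (i <= r)%N ->
    (forall j, (j <= r.+1)%N -> (t <= j)%N -> (i < t)%N ->
       (W j)@_(mono z a b) = 0) ->
    \sum_(j < r.+2) syzmx c e i j 0 * (W j)@_(mono z a b) = 0.
  move=> hi h; apply: big1 => j _.
  have [->|nz] := eqVneq (syzmx c e i j 0) 0; first by rewrite mul0r.
  have /andP[hit htj] := syzmx_const ht hi nz.
  by rewrite h ?mulr0 // -ltnS ltn_ord.
case: (eqVneq z 0%MM) => [->|nz]; first by move=> j a b; exact: hW0.
(* Read at the exponent [b] of [y], the relations lose their [y]-term. Constant entries point to
   rows from [t] on, so the rows beyond [t] come first, then row [t] through the pivot, then the
   rows below [t]. *)
have step b : (forall i a, (i <= r)%N -> (b <= i)%N ->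
      (if b is b'.+1 then (W i)@_(mono z a b') else 0) = 0) ->
    forall j a, (j <= r.+1)%N -> (b < j)%N -> (W j)@_(mono z a b) = 0.
  move=> hl.
  have above_t j a : (t < j)%N -> (j <= r.+1)%N -> (b < j)%N ->
      (W j)@_(mono z a b) = 0.
    case: j => // j htj hj hbj; have := R j a.+1 b hj.
    rewrite hl // sum0 //; last by lia.
    have -> : j.+1 != t by lia.
    by rewrite addr0.
  have at_t a : (t <= r.+1)%N -> (b < t)%N -> (W t)@_(mono z a b) = 0.
    move=> htr hbt; have hp : (t.-1 <= r)%N by lia.
    have := R t.-1 a b hp; rewrite hl //; last by lia.
    rewrite prednK ?eqxx ?mulr0n ?add0r; last by lia.
    rewrite (bigD1 (Ordinal (htr : (t < r.+2)%N))) //= syzmx_pivot // mul1r.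
    rewrite big1 ?addr0 => [->//|j /eqP hj].
    have [->|nz'] := eqVneq (syzmx c e t.-1 j 0) 0; first by rewrite mul0r.
    have /andP[_ htj] := syzmx_const ht hp nz'.
    rewrite above_t ?mulr0 //; [|by rewrite -ltnS|].
      by rewrite ltn_neqAle htj andbT; apply/eqP => e'; apply: hj; exact: val_inj.
    by apply: leq_trans htj.
  have from_t j a : (t <= j)%N -> (j <= r.+1)%N -> (b < j)%N ->
      (W j)@_(mono z a b) = 0.
    rewrite leq_eqVlt => /predU1P[<-|]; [exact: at_t|exact: above_t].
  move=> j a hj hbj; case: (leqP t j) => [htj|hjt]; first exact: from_t.
  case: j hj hbj hjt => // j hj hbj hjt; have := R j a.+1 b hj.
  rewrite hl // sum0 //; last by move=> j' hj' htj' _; apply: from_t => //; lia.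
  have -> : j.+1 != t by lia.
  by rewrite addr0.
have low b : forall j a, (j <= r.+1)%N -> (b < j)%N -> (W j)@_(mono z a b) = 0.
  elim: b => [|b IHb]; apply: step => // i a hi hbi.
  by apply: IHb => //; apply: leq_trans hi _.
have bottom a b : (W r.+1)@_(mono z a b) = 0.
  case: (ltnP b r.+1) => hb; first exact: low.
  by apply: hWr => //; move: nz; rewrite -mdeg_eq0; lia.
(* Read at [b.+1], the relation of row [j] now expresses this row by rows of larger index. *)
have down m : forall j a b, (j <= r.+1)%N -> (r.+1 - j <= m)%N ->
    (W j)@_(mono z a b) = 0.
  elim: m => [|m IHm] j a b hj hm.
    by have -> : j = r.+1 by lia.
  case: (eqVneq j r.+1) => [->//|hjr].
  have hj' : (j <= r)%N by lia.
  have := R j a b.+1 hj' => /= ->; rewrite sum0 ?addr0 //; last first.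
    by move=> j' hj1 htj hjt; apply: IHm => //; lia.
  case: a => [|a]; first by rewrite mul0rn.
  by rewrite IHm ?mul0rn //; lia.
by move=> j a b hj; exact: (down r.+1 j a b hj (leq_subr _ _)).
Qed.

(** By degree, the only z-free tail monomials are [x ^ (r - b) * y ^ b] with [t <= b <= r], in rows
    below [t]. *)
Lemma marked_pure H H' : marked r t H -> marked r t H' ->
  (forall i j, (i < t)%N -> (t <= j <= r)%N -> topcoef r H i j = topcoef r H' i j) ->
  forall j a b, (j <= r.+1)%N -> (H j)@_(mono 0 a b) = (H' j)@_(mono 0 a b).
Proof.
move=> hH hH' hc j a b hj.
have [h0 h1] := hH j hj 0%MM a b (zmon0 q).
have [h0' h1'] := hH' j hj 0%MM a b (zmon0 q).
case: (eqVneq (mdeg (0%MM : 'X_{1..q.+2}) + a + b)%N (rowdeg r t j)) => hd; last first.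
  by rewrite h0 ?h0'.
case: (leqP (stair r t b) a) => hs; first by rewrite h1 ?h1'.
move: hd hs; rewrite mdeg0 add0n /rowdeg /stair.
case: (ltnP j t) => hjt; case: (ltnP b t) => hbt; try lia.
move=> hd hs; have := hc j b hjt; rewrite /topcoef.
have -> : (r - b)%N = a by lia.
by apply; lia.
Qed.

Lemma marked_syzrel_unique c e H H' :
  marked r t H -> marked r t H' ->
  syzrel r t (syzmx c e) H -> syzrel r t (syzmx c e) H' ->
  (forall i j, (i < t)%N -> (t <= j <= r)%N -> topcoef r H i j = topcoef r H' i j) ->
  forall j, (j <= r.+1)%N -> H j = H' j.
Proof.
move=> hH hH' hr hr' hc j hj; apply/eqP; rewrite -subr_eq0; apply/eqP.
apply: (syzrel_eq0 (syzrelB hr hr')) => // {hj}.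
  by move=> i a b hi; rewrite mcoeffB (marked_pure hH hH') ?subrr.
move=> z a b hz hd; rewrite mcoeffB.
have hrd : rowdeg r t r.+1 = r.+1 by rewrite /rowdeg; case: ltnP => //; lia.
by rewrite (hH r.+1 _ z a b hz).1 ?(hH' r.+1 _ z a b hz).1 ?subr0 ?hrd.
Qed.

End Uniqueness.

(** * Existence of solutions *)

Section Existence.

Variables q r t : nat.
Hypothesis ht : (0 < t <= r.+1)%N.
Variable K : comNzRingType.
Local Notation S := {mpoly K[q.+2]}.
Variables (e : nat -> nat -> 'X_{1..q.+2} -> K) (c : nat -> nat -> K).
Local Notation b := (@syzmx q r t K c e).

Definition syzentry i j : S :=
  'X_(ix q) *+ ((j == i.+1) && (i.+1 != t)) + zpoly (b i j).

(* The full matrix of relations has size [r.+1 * r.+2]; its last column is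
   kept apart, so that its maximal minors come from Cramer's rule. *)
Definition square_syz : 'M[S]_r.+1 :=
  \matrix_(i, j) ('X_(iy q) *+ (i == j) - syzentry i j).

Definition minors j : S :=
  if (j <= r)%N then
    (\adj square_syz *m \col_(i < r.+1) syzentry i r.+1) (inord j) 0
  else \det square_syz.

Lemma minors_last : minors r.+1 = \det square_syz.
Proof. by rewrite /minors ltnn. Qed.

Lemma minorsE i : (i <= r)%N ->
  'X_(iy q) * minors i = \sum_(j < r.+2) syzentry i j * minors j.
Proof.
move=> hi; pose i' : 'I_r.+1 := Ordinal (hi : (i < r.+1)%N).
pose u : 'cV[S]_r.+1 := \col_i syzentry i r.+1.
have := congr1 (fun M : 'cV[S]_r.+1 => M i' 0)
  (mulmxA square_syz (\adj square_syz) u).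
rewrite mul_mx_adj mul_scalar_mx !mxE => E; rewrite [RHS]big_ord_recr /=.
rewrite minors_last [X in _ = _ + X]mulrC -E.
under [X in _ = X + _]eq_bigr => j _ do rewrite /minors (ltn_ord j : (j <= r)%N).
under [X in _ = _ + X]eq_bigr => j _ do rewrite [square_syz _ _]mxE mulrBl.
rewrite sumrB [X in _ + (X - _)](bigD1 i') //= eqxx mulr1n.
rewrite [X in _ + X - _]big1 ?addr0 => [|j /negbTE hj]; last first.
  by rewrite eq_sym hj mulr0n mul0r.
rewrite /minors hi; set s1 := \sum_i _; set s2 := \sum_i _.
have -> : s1 = s2 by apply: eq_bigr => j _; rewrite inord_val.
rewrite (_ : inord i = i'); first by ring.
by apply: val_inj; rewrite /= inordK.
Qed.

Lemma minors_syzrel : syzrel r t b minors.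
Proof.
move=> i hi; rewrite /syz minorsE //.
under eq_bigr do rewrite mulrDl.
rewrite big_split /= addrC; apply/eqP; rewrite subr_eq; apply/eqP; congr (_ + _).
rewrite (bigD1 (Ordinal (hi : (i.+1 < r.+2)%N))) //= eqxx /= big1 ?addr0.
  by rewrite mulrnAl.
move=> j /eqP hj; rewrite (_ : (j == i.+1 :> nat) = false) ?mul0r //.
by apply/eqP => e'; apply: hj; exact: val_inj.
Qed.

(** * Specialization of the minors at [z = 0] *)

Definition kill_z : {rmorphism S -> S} :=
  mmap (@mpolyC q.+2 K) (fun i : 'I_q.+2 => if (i < 2)%N then 'X_i else 0).

Lemma kill_zX m : kill_z 'X_[m] = if zpart m == 0%MM then 'X_[m] else 0.
Proof.
rewrite /kill_z /= mmapX /mmap1; case: eqP => hm.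
  rewrite [RHS]mpolyXE_id; apply: eq_bigr => i _; case: ltnP => hi //.
  have := congr1 (fun m => fun_of_multinom m i) hm.
  by rewrite mnmE mnm0E ltnNge hi /= => ->; rewrite !expr0.
have [i hi]: exists i, zpart m i != 0%N.
  apply/existsP; apply: contra_notT hm; rewrite negb_exists => /forallP h.
  by apply/mnmP => i; rewrite mnm0E; apply/eqP; rewrite -[_ == _]negbK.
rewrite (bigD1 i) //=; move: hi; rewrite mnmE; case: ltnP => // _ hi.
by rewrite expr0n (negbTE hi) mul0r.
Qed.

Lemma kill_zZ k p : kill_z (k *: p) = k *: kill_z p.
Proof. by rewrite /kill_z /= mmapZ mul_mpolyC. Qed.

Lemma mcoeff_kill_z p z a b' : zmon z ->
  (kill_z p)@_(mono z a b') = if z == 0%MM then p@_(mono 0 a b') else 0.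
Proof.
move=> hz; elim/mpolyind: p => [|k m p _ _ IH].
  by rewrite rmorph0 !mcoeff0 if_same.
rewrite rmorphD !mcoeffD IH kill_zZ.
rewrite mcoeffZ kill_zX; case: ifP => hm.
  rewrite mcoeffX; case: (eqVneq z 0%MM) => [->|nz].
    by rewrite mcoeffZ mcoeffX.
  case: eqP => [e'|_]; rewrite ?mulr0 ?addr0 //.
  by move: nz; rewrite -(zpart_mono a b' hz) -e' hm.
rewrite mcoeff0 mulr0 add0r mcoeffZ mcoeffX; case: (m =P _) => [e'|_].
  by rewrite e' zpart_mono ?eqxx // in hm; exact: zmon0.
by rewrite mulr0 add0r.
Qed.

Lemma kill_z_zpoly f : (forall g, ~~ zmon g -> f g = 0) ->
  kill_z (zpoly f) = (f 0%MM)%:MP.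
Proof.
move=> hf; rewrite /zpoly rmorph_sum (bigD1 bm0) //= big1 ?addr0.
  rewrite kill_zZ kill_zX.
  have -> : zpart 0%MM = 0%MM :> 'X_{1..q.+2}.
    by apply/mnmP => i; rewrite mnmE mnm0E if_same.
  by rewrite eqxx mpolyX0 alg_mpolyC.
move=> g g0; rewrite kill_zZ kill_zX.
case: eqP => hg; rewrite ?scaler0 //.
rewrite hf ?scale0r //; apply/negP => hz.
move: g0; rewrite bmeqP /=; move: hg.
by rewrite -{1}[bmnm g]mono00 zpart_mono // => ->; rewrite eqxx.
Qed.

(** At [z = 0] the square matrix is upper triangular with [y] on the diagonal: [x] stands just above
    it, and constant entries satisfy [i < t <= j]. *)
Lemma kill_z_minors_last : kill_z (minors r.+1) = 'X_(iy q) ^+ r.+1.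
Proof.
rewrite minors_last -det_map_mx -det_tr det_trig.
  rewrite -[X in _ ^+ X]card_ord -prodr_const; apply: eq_bigr => i _.
  rewrite !mxE eqxx mulr1n rmorphB rmorphD rmorphMn /= kill_z_zpoly; last first.
    by move=> g; exact: syzmx_zmon.
  have -> : b i i 0 = 0.
    apply/eqP; apply: contraT => nz; have := syzmx_const ht (ltn_ord i) nz; lia.
  have -> : (i == i.+1 :> nat) = false by lia.
  rewrite mulr0n mpolyC0 addr0 subr0 kill_zX.
  rewrite (_ : zpart _ = 0%MM) ?eqxx //; apply/mnmP => j.
  rewrite mnmE mnm0E mnm1E; case: (ixP j) => [->|->|hj] //.
  by rewrite ge2_iy // if_same.
apply/is_trig_mxP => i j hij; rewrite !mxE.
rewrite (_ : (j == i) = false) ?mulr0n; last by apply/eqP => e'; rewrite e' ltnn in hij.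
rewrite sub0r rmorphN rmorphD rmorphMn /= kill_z_zpoly; last first.
  by move=> g; exact: syzmx_zmon.
have -> : b j i 0 = 0.
  apply/eqP; apply: contraT => nz; have := syzmx_const ht (ltn_ord j) nz; lia.
have -> : (i == j.+1 :> nat) = false by lia.
by rewrite mulr0n mpolyC0 addr0 oppr0.
Qed.

(** The z-free part that row [j] of the solution must have: only rows below [t] have a tail there,
    with the prescribed coefficients [c]. *)
Definition leading j a b' : K :=
  if (j < t)%N then (if (a + b' == r)%N then toprow r t c j b' else 0)
  else ((a == stair r t j) && (b' == j))%:R.

(** These are the relations modulo the z's; the degree zero entries of [syzmx] are defined exactly
    so that they hold. *)
Lemma leading_syz i a b' : (i <= r)%N ->
  leading i a b' =
  (if a is a'.+1 then leading i.+1 a' b'.+1 else 0) *+ (i.+1 != t) +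
  \sum_(j < r.+2) b i j 0 * leading j a b'.+1.
Proof.
move=> hi; case: (ltnP i t) => hit; last first.
  rewrite big1 => [|j _]; last first.
    have [->|nz] := eqVneq (b i j 0) 0; first by rewrite mul0r.
    by have := syzmx_const ht hi nz; lia.
  have -> : i.+1 != t by lia.
  rewrite addr0 mulr1n /leading !ltnNge hit (leqW hit) /= /stair !ltnNge hit (leqW hit) /=.
  by case: a => [|a]; rewrite ?subn0; [rewrite (_ : (0 == r.+1 - i)%N = false) //; lia|];
     congr (_%:R); lia.
have -> : \sum_(j < r.+2) b i j 0 * leading j a b'.+1 =
    if (t <= b'.+1)%N && (a + b' == r)%N then b i b'.+1 0 else 0.
  case: ifP => [/andP[htb /eqP hab]|hn].
    have hb : (b'.+1 < r.+2)%N by lia.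
    rewrite (bigD1 (Ordinal hb)) //= big1 ?addr0.
      rewrite /leading ltnNge htb /= /stair ltnNge htb /= eqxx andbT.
      by rewrite (_ : (a == _) = true) ?mulr1 //; lia.
    move=> j /eqP hj; have [->|nz] := eqVneq (b i j 0) 0; first by rewrite mul0r.
    have /andP[_ htj] := syzmx_const ht hi nz.
    rewrite /leading ltnNge htj /= (_ : (b'.+1 == j :> nat) = false) ?andbF ?mulr0 //.
    by apply/eqP => e'; apply: hj; exact: val_inj.
  apply: big1 => j _; have [->|nz] := eqVneq (b i j 0) 0; first by rewrite mul0r.
  have /andP[_ htj] := syzmx_const ht hi nz; have hj := ltn_ord j.
  rewrite /leading ltnNge htj /= /stair ltnNge htj /=.
  rewrite (_ : _ && _ = false) ?mulr0 //; apply/negP => /andP[/eqP ha /eqP hb].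
  by move: hn; rewrite hb htj ha /=; lia.
rewrite {1}/leading hit; case: (eqVneq (a + b')%N r) => hab; last first.
  rewrite andbF addr0; case: a hab => [|a] hab; first by rewrite mul0rn.
  case: eqP => [_|hit']; rewrite ?mulr0n // mulr1n /leading.
  by rewrite (_ : (i.+1 < t)%N); [rewrite ifN //|]; lia.
rewrite andbT.
have hd : rowdeg r t i = r by rewrite /rowdeg hit.
case: (leqP t b'.+1) => htb.
  rewrite /syzmx zmon0 mdeg0 add0n /= hd hit /rowdeg ltnNge htb /= eqxx /=.
  have -> : (if a is a'.+1 then leading i.+1 a' b'.+1 else 0) *+ (i.+1 != t) =
     toprow r t c i.+1 b'.+1 *+ (i.+1 != t).
    case: eqP => hit'; rewrite ?mulr0n // !mulr1n.
    case: a hab => [|a] hab.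
      by rewrite /toprow; do 2![case: ifP; try lia].
    by rewrite /leading (_ : (i.+1 < t)%N) 1?(_ : (a + b'.+1 == r)%N) //; lia.
  by rewrite addrC subrK.
rewrite addr0 /toprow (_ : (b' < t)%N); last by lia.
case: (i.+1 =P t) => hit'; rewrite ?mulr0n ?mulr1n.
  by rewrite (_ : (i == b') = false) //; lia.
case: a hab => [|a] hab; first by lia.
rewrite /leading (_ : (i.+1 < t)%N); last by lia.
by rewrite (_ : (a + b'.+1 == r)%N) /toprow ?htb //; lia.
Qed.

(** Descending induction from the determinant. Comparing coefficients at [y ^ b'.+1] takes the place
    of a division by [y]. *)
Lemma minors_leading j a b' : (j <= r.+1)%N ->
  (minors j)@_(mono 0 a b') = leading j a b'.
Proof.
move=> hj; have [m hm] := ubnP (r.+1 - j)%N; elim: m j hj hm a b' => // m IH j hj hm a b'.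
case: (eqVneq j r.+1) => [->|hjr].
  have := mcoeff_kill_z (minors r.+1) a b' (zmon0 q).
  rewrite eqxx kill_z_minors_last => <-.
  rewrite mpolyXn mcoeffX /leading ltnNge (_ : (t <= r.+1)%N) /=; last by lia.
  rewrite /stair ltnNge (_ : (t <= r.+1)%N) /= ?subnn; last by lia.
  have -> : (U_(iy q) *+ r.+1)%MM = mono 0 0 r.+1 by rewrite /mono mulm0n !add0m.
  by rewrite mono_eq ?zmon0 // eqxx /= eq_sym [(r.+1 == _)]eq_sym.
have hi : (j <= r)%N by lia.
rewrite leading_syz //.
have := syzrel_coef a b'.+1 minors_syzrel hi (zmon0 q) => /= ->; congr (_ *+ _ + _).
  by case: a => // a; apply: IH; lia.
apply: eq_bigr => k _; rewrite (bigD1 bm0) /=; last by apply/mnm_lepP => ?; rewrite mnm0E.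
rewrite subm0 big1 ?addr0; last first.
  move=> g /andP[hg]; rewrite bmeqP /=; case/negP; apply/eqP/mnmP => s.
  by move/mnm_lepP: hg => /(_ s); rewrite !mnm0E; lia.
have [->|nz] := eqVneq (b j k 0) 0; first by rewrite !mul0r.
have := syzmx_const ht hi nz; have := ltn_ord k => h1 h2.
by rewrite IH //; lia.
Qed.

End Existence.

(** * Homogeneity and reducedness of the solution *)

Section ExistenceMarked.

Variables q r t : nat.
Hypothesis ht : (0 < t <= r.+1)%N.
Variable K : comNzRingType.
Local Notation S := {mpoly K[q.+2]}.
Variables (e : nat -> nat -> 'X_{1..q.+2} -> K) (c : nat -> nat -> K).
Local Notation b := (@syzmx q r t K c e).

Definition homog_part d (p : S) : S :=
  \sum_(m : 'X_{1..q.+2 < d.+1})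
    (if mdeg m == d then p@_m else 0) *: 'X_[bmnm m].

Lemma mcoeff_homog_part d p m :
  (homog_part d p)@_m = if mdeg m == d then p@_m else 0.
Proof.
case: (leqP (mdeg m) d) => hm.
  by rewrite (mcoeff_mpoly (fun m => if mdeg m == d then p@_m else 0)).
rewrite ifN; last by lia.
rewrite raddf_sum big1 // => g _ /=; rewrite mcoeffZ mcoeffX.
case: (bmnm g =P m) => [e'|]; last by rewrite mulr0.
by have := bmdeg g; rewrite e'; lia.
Qed.

(** The relations are graded, so these components solve them again; homogeneity is thereby built in
    instead of being read off the determinants. *)
Definition sol j : S := homog_part (rowdeg r t j) (minors r t e c j).

Lemma sol_syzrel : syzrel r t b sol.
Proof.
move=> i hi; apply: mono_polyP => z a b' hz.
have R := syzrel_coef a b' (@minors_syzrel q r t K e c) hi hz.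
rewrite mcoeff_syz // raddf_sum /=.
under eq_bigr => j _.
  rewrite mcoeff_zpolyM //; last by move=> g; exact: syzmx_zmon.
  over.
apply/eqP; rewrite subr_eq addrC; apply/eqP.
case: (eqVneq (mdeg z + (a + b'))%N (rowdeg r t i).+1) => hd; last first.
  have -> : (if b' is b'.+1 then (sol i)@_(mono z a b') else 0) = 0.
    case: b' hd {R} => // b' hd; rewrite mcoeff_homog_part mdeg_mono ifN //; lia.
  rewrite (_ : _ *+ _ = 0); last first.
    case: eqP => [_|/eqP hit]; rewrite ?mulr0n // mulr1n.
    case: a hd {R} => // a hd; rewrite mcoeff_homog_part mdeg_mono rowdegS // ifN //; lia.
  rewrite add0r big1 // => j _; rewrite big1 // => g hg.
  case: (eqVneq (mdeg (bmnm g) + rowdeg r t j)%N (rowdeg r t i).+1) => hg'.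
    rewrite mcoeff_homog_part mdeg_mono ifN ?mulr0 //.
    by have := mdegD (z - bmnm g) (bmnm g); rewrite submK //; lia.
  by rewrite syzmx_deg ?mul0r.
have -> : (if b' is b'.+1 then (sol i)@_(mono z a b') else 0) =
  (if b' is b'.+1 then (minors r t e c i)@_(mono z a b') else 0).
  case: b' hd {R} => // b' hd; rewrite mcoeff_homog_part mdeg_mono ifT //; lia.
rewrite R; congr (_ + _).
  case: eqP => [_|/eqP hit]; rewrite ?mulr0n // !mulr1n.
  case: a hd {R} => // a hd; rewrite mcoeff_homog_part mdeg_mono rowdegS // ifT //; lia.
apply: eq_bigr => j _; apply: eq_bigr => g hg.
case: (eqVneq (mdeg (bmnm g) + rowdeg r t j)%N (rowdeg r t i).+1) => hg'.
  rewrite mcoeff_homog_part mdeg_mono ifT //.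
  by have := mdegD (z - bmnm g) (bmnm g); rewrite submK //; lia.
by rewrite syzmx_deg ?mul0r.
Qed.

Lemma leading_deg j a b' : (j <= r.+1)%N -> (a + b' != rowdeg r t j)%N ->
  leading r t c j a b' = 0.
Proof.
move=> hj; rewrite /leading /rowdeg; case: ltnP => hjt hd.
  by rewrite (negbTE hd).
have := stairD ht hj; rewrite /rowdeg ltnNge hjt /= => hs.
rewrite (_ : _ && _ = false) //; apply/negP => /andP[/eqP ha /eqP hb]; lia.
Qed.

Lemma sol_leading j a b' : (j <= r.+1)%N ->
  (sol j)@_(mono 0 a b') = leading r t c j a b'.
Proof.
move=> hj; rewrite mcoeff_homog_part mdeg_mono mdeg0 add0n minors_leading //.
by case: eqVneq => // hd; rewrite leading_deg.
Qed.

Lemma leading_stair j a b' : (j <= r.+1)%N -> (stair r t b' <= a)%N ->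
  leading r t c j a b' = ((a == stair r t j) && (b' == j))%:R.
Proof.
move=> hj hs; rewrite /leading; case: ltnP => // hjt.
case: eqVneq => hd; last first.
  rewrite (_ : _ && _ = false) //; apply/negP => /andP[/eqP ha /eqP hb].
  by have := stairD ht hj; rewrite /rowdeg hjt; lia.
move: hs; rewrite /stair hjt /toprow; case: ltnP => hbt hs; last by lia.
by rewrite [b' == j]eq_sym; case: eqP => [->|_]; rewrite ?andbF // andbT; congr (_%:R); lia.
Qed.

(** A variable factors only trivially: either the entry contributes a constant and the solution [z],
    or the entry contributes [z] and the solution its known z-free part. *)
Lemma sol_syz1 i z a b' : (i <= r)%N -> zmon z -> mdeg z = 1%N ->
  (if b' is b'.+1 then (sol i)@_(mono z a b') else 0) =
  (if a is a'.+1 then (sol i.+1)@_(mono z a' b') else 0) *+ (i.+1 != t) +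
  (\sum_(j < r.+2) b i j 0 * (sol j)@_(mono z a b') +
   \sum_(j < r.+2) b i j z * leading r t c j a b').
Proof.
move=> hi hz hd; rewrite (syzrel_coef a b' sol_syzrel hi hz) -big_split /=.
congr (_ + _); apply: eq_bigr => j _.
have hz3 : (mdeg z < 3)%N by rewrite hd.
have z0 : z != 0%MM by rewrite -mdeg_eq0 hd.
rewrite (bigD1 bm0) /=; last by apply/mnm_lepP => ?; rewrite mnm0E.
rewrite subm0; congr (_ + _).
rewrite (bigD1 (BMultinom hz3)) /=; last by rewrite lepm_refl bmeqP.
have -> : (z - z = 0)%MM by apply/mnmP => s; rewrite mnmBE subnn mnm0E.
have hj : (j <= r.+1)%N by rewrite -ltnS.
rewrite (sol_leading a b' hj) [X in _ + X = _]big1 ?addr0 // => g.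
rewrite !bmeqP /= => /andP[/andP[hg g0] gz]; exfalso.
have E := submK hg; have D := mdegD (z - bmnm g) (bmnm g).
have : mdeg (bmnm g) != 0%N by rewrite mdeg_eq0.
have : mdeg (z - bmnm g)%MM != 0%N.
  rewrite mdeg_eq0; apply: contraNneq gz => e'.
  by rewrite -E e' add0m.
by move: D; rewrite E; lia.
Qed.

(* Among the monomials of the ideal only [z * lead m] with [m < t] could spoil
   the reducedness of the rows [j >= t]. *)
Lemma sol_linear_step z m : zmon z -> mdeg z = 1%N -> (m < t)%N ->
  (forall j, (t <= j <= r.+1)%N ->
     (if m is m'.+1 then (sol j)@_(mono z (r - m') m') else 0) = 0) ->
  (forall i, (m <= i < t)%N ->
     (if m is m'.+1 then (sol i)@_(mono z (r - m) m') else 0) =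
     (if m is m'.+1 then telescope (fun i m => e i m z) m' i else 0)) ->
  (forall j, (t <= j <= r.+1)%N -> (sol j)@_(mono z (r - m) m) = 0) /\
  (forall i, (m < i < t)%N -> (sol i)@_(mono z (r - m.+1) m) =
      telescope (fun i m => e i m z) m i).
Proof.
move=> hz hd hmt hP hQ.
have hmr : (m <= r)%N by lia.
(* The relation of the preceding row, read with one more factor [x], has no other surviving term:
   this row is at least [t], so it has no constant entries, and its entries in columns below [t]
   have degree 2. *)
have above j : (t < j <= r.+1)%N -> (sol j)@_(mono z (r - m) m) = 0.
  case: j => // j hj; have hjr : (j <= r)%N by lia.
  have := sol_syz1 (r - m).+1 m hjr hz hd => /=.
  have -> : (if m is b'.+1 then (sol j)@_(mono z (r - m).+1 b') else 0) = 0.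
    have hj' : (t <= j <= r.+1)%N by lia.
    by have := hP j hj'; case: m hmt hmr {hP hQ} => // m _ hmr; rewrite subnSK.
  rewrite (_ : j.+1 != t); last by lia.
  rewrite mulr1n [X in _ + (X + _)]big1 => [|k _]; last first.
    have [->|nz] := eqVneq (b j k 0) 0; first by rewrite mul0r.
    by have := syzmx_const ht hjr nz; lia.
  rewrite [X in _ + (_ + X)]big1 => [|k _]; first by rewrite !addr0.
  have hk : (k <= r.+1)%N by rewrite -ltnS.
  rewrite leading_stair //; last by rewrite /stair hmt; lia.
  case: eqP => [_|]; rewrite ?mulr0 //=; case: eqP => [hmk|]; rewrite ?mulr0 // mulr1.
  by rewrite syzmx_deg // hd /rowdeg -hmk hmt ifN; lia.
have const i : (i <= r)%N ->
    \sum_(j < r.+2) b i j 0 * (sol j)@_(mono z (r - m) m) =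
    b i t 0 * (sol t)@_(mono z (r - m) m).
  move=> hi; have htr : (t < r.+2)%N by lia.
  rewrite (bigD1 (Ordinal htr)) //= big1 ?addr0 // => j /eqP hj.
  have [->|nz] := eqVneq (b i j 0) 0; first by rewrite mul0r.
  have /andP[_ htj] := syzmx_const ht hi nz; have hjr := ltn_ord j.
  rewrite above ?mulr0 //; apply/andP; split=> //.
  by rewrite ltn_neqAle htj andbT; apply/eqP => e'; apply: hj; exact: val_inj.
have lin i : (i <= r)%N ->
    \sum_(j < r.+2) b i j z * leading r t c j (r - m) m = b i m z.
  move=> hi; have hm : (m < r.+2)%N by lia.
  rewrite (bigD1 (Ordinal hm)) //= big1 ?addr0 => [|j /eqP hj].
    rewrite leading_stair //; last by rewrite /stair hmt.
    by rewrite /stair hmt !eqxx mulr1.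
  have hjr : (j <= r.+1)%N by rewrite -ltnS.
  rewrite (leading_stair hjr); last by rewrite /stair hmt.
  rewrite (_ : (m == j) = false) ?andbF ?mulr0 //.
  by apply/eqP => e'; apply: hj; exact: val_inj.
(* The pivot 1 isolates the coefficient of row [t] in the relation of row [t.-1], and the telescoped
   entry of that row is chosen to cancel the rest. *)
have at_t : (sol t)@_(mono z (r - m) m) = 0.
  have hp : (t.-1 <= r)%N by lia.
  have := sol_syz1 (r - m) m hp hz hd; rewrite const // lin //.
  rewrite prednK ?eqxx ?mulr0n ?add0r; last by lia.
  rewrite syzmx_pivot // mul1r hQ; last by lia.
  rewrite /syzmx hz hd /= /rowdeg hmt (_ : (t.-1 < t)%N); last by lia.
  rewrite eqxx /= leqNgt hmt /= prednK ?eqxx; last by lia.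
  by move/eqP; rewrite -subr_eq subrr => /eqP.
split=> [j /andP[htj hj]|i /andP[hmi hit]].
  by move: htj; rewrite leq_eqVlt => /predU1P[<-//|htj]; apply: above; rewrite htj.
case: i hmi hit => // i hmi hit; have hi : (i <= r)%N by lia.
have := sol_syz1 (r - m) m hi hz hd; rewrite const // lin // at_t mulr0 add0r.
rewrite hQ; last by lia.
rewrite (_ : i.+1 != t); last by lia.
rewrite mulr1n (_ : (r - m = (r - m.+1).+1)%N); last by lia.
move=> /eqP; rewrite -subr_eq => /eqP <-.
have hi2 : (i < t)%N by lia.
rewrite /syzmx hz hd /= /rowdeg hmt hi2 eqxx /= leqNgt hmt /= ifN; last by lia.
by case: (m).
Qed.

Lemma sol_linear z m j : zmon z -> mdeg z = 1%N -> (m < t)%N ->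
  (t <= j <= r.+1)%N -> (sol j)@_(mono z (r - m) m) = 0.
Proof.
move=> hz hd hmt; suff [h _] : 
  (forall j, (t <= j <= r.+1)%N -> (sol j)@_(mono z (r - m) m) = 0) /\
  (forall i, (m < i < t)%N -> (sol i)@_(mono z (r - m.+1) m) =
      telescope (fun i m => e i m z) m i) by apply: h.
elim: m hmt => [|m IH] hmt; first exact: sol_linear_step.
by have [hP hQ] := IH (ltnW hmt); apply: sol_linear_step.
Qed.

Lemma sol_marked : marked r t sol.
Proof.
move=> j hj z a b' hz; split=> [hd|hs].
  by rewrite mcoeff_homog_part mdeg_mono addnA (negbTE hd).
have [z0|z0] := eqVneq z 0%MM; first by rewrite z0 sol_leading // leading_stair.
rewrite /=; case: (eqVneq (mdeg z + (a + b'))%N (rowdeg r t j)) => hd; last first.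
  by rewrite mcoeff_homog_part mdeg_mono (negbTE hd).
have z1 : mdeg z != 0%N by rewrite mdeg_eq0.
have [hbt htj] : (b' < t)%N /\ (t <= j)%N.
  move: hd hs; rewrite /rowdeg /stair.
  by case: (ltnP j t) => h1; case: (ltnP b' t) => h2 h3 h4; split; lia.
move: hd hs; rewrite /rowdeg /stair hbt ltnNge htj /= => hd hs.
have -> : a = (r - b')%N by lia.
apply: sol_linear => //; lia.
Qed.

End ExistenceMarked.

(** * Marked bases *)

Section Complement.

Variables q r t : nat.
Hypothesis ht : (0 < t <= r.+1)%N.
Variable K : comNzRingType.
Local Notation S := {mpoly K[q.+2]}.
Local Notation lead := (@lead q r t).
Local Notation inJ := (@inJ q r t).
Variables (e : nat -> nat -> 'X_{1..q.+2} -> K) (c : nat -> nat -> K).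
Variable H : nat -> S.
Hypothesis hH : marked r t H.
Hypothesis hrel : syzrel r t (syzmx r t c e) H.
Implicit Types (m : 'X_{1..q.+2}).

(** Source of the triangularity at equal z-degree: a z-free tail monomial always has a larger
    exponent of [y] than the leading one. *)
Lemma pure_support j a b : (j <= r.+1)%N -> (H j)@_(mono 0 a b) != 0 ->
  (a = stair r t j /\ b = j) \/ (j < b)%N.
Proof.
move=> hj; have [h0 h1] := hH hj a b (zmon0 q).
have [hd nz|/h0->] := eqVneq (mdeg (0%MM : 'X_{1..q.+2}) + a + b)%N (rowdeg r t j);
  last by rewrite eqxx.
case: (leqP (stair r t b) a) => hs; last first.
  right; move: hd hs; rewrite mdeg0 /rowdeg /stair.
  by case: (ltnP j t) => ?; case: (ltnP b t) => ?; lia.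
left; move: nz; rewrite h1 // eqxx /=; case: andP => [[/eqP-> /eqP->]//|_].
by rewrite eqxx.
Qed.

(* Each monomial of the ideal is a multiple of exactly one [lead j] by a
   monomial without [y], unless [j = r.+1]: as the relations rewrite [y H_j],
   the corresponding multiples of the [H_j] span the ideal, and they are
   triangular for the pair (degree in the [z]'s, exponent of [y]). *)
Definition lrow m := minn (m (iy q)) r.+1.

Definition multiple m : S := 'X_[m - lead (lrow m)] * H (lrow m).

Lemma lrow_le m : (lrow m <= r.+1)%N.
Proof. exact: geq_minr. Qed.

Lemma lead_le m : inJ m -> (lead (lrow m) <= m)%MM.
Proof.
move=> hm; have -> : lead (lrow m) = mono 0 (stair r t (lrow m)) (lrow m) by [].
apply/mnm_lepP => i; case: (ixP i) => [->|->|hi].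
- rewrite mono_x ?zmon0 //; move: hm; rewrite /inJ /lrow.
  case: (leqP (m (iy q)) r.+1) => // h _; rewrite /stair; case: ltnP; lia.
- by rewrite mono_y ?zmon0 // geq_minl.
by rewrite monoE ge2_ix // ge2_iy // mnm0E.
Qed.

Lemma lead_sub m : inJ m ->
  (m - lead (lrow m))%MM = mono (zpart m) (m (ix q) - stair r t (lrow m))
    (m (iy q) - lrow m).
Proof.
move=> hm; have -> : lead (lrow m) = mono 0 (stair r t (lrow m)) (lrow m) by [].
apply/mnmP => i; rewrite mnmBE; case: (ixP i) => [->|->|hi].
- by rewrite !mono_x ?zmon0 ?zmon_zpart.
- by rewrite !mono_y ?zmon0 ?zmon_zpart.
by rewrite !monoE ge2_ix // ge2_iy // mnm0E mnmE ltnNge hi /=; lia.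
Qed.

Lemma multiple_lead m : inJ m -> (multiple m)@_m = 1.
Proof.
move=> hm; rewrite /multiple -[X in _@_X](submK (lead_le hm)) mcoeffXMD.
have [_ h] := hH (lrow_le m) (stair r t (lrow m)) (lrow m) (zmon0 q).
by rewrite h // !eqxx.
Qed.

Lemma multiple_support m m' : inJ m -> (multiple m)@_m' != 0 ->
  [\/ m' = m, (mdeg (zpart m) < mdeg (zpart m'))%N
    | mdeg (zpart m) = mdeg (zpart m') /\ (m (iy q) < m' (iy q))%N].
Proof.
move=> hm; rewrite /multiple mcoeffXM; case: ifP => [hle|]; last by rewrite eqxx.
rewrite lead_sub // in hle *.
have hz : (zpart m <= zpart m')%MM.
  apply/mnm_lepP => i; move/mnm_lepP: hle => /(_ i); rewrite monoE !mnmE.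
  by case: ltnP => // hi; rewrite ge2_ix // ge2_iy // addn0.
have hx : (m (ix q) - stair r t (lrow m) <= m' (ix q))%N.
  by move/mnm_lepP: hle => /(_ (ix q)); rewrite mono_x ?zmon_zpart.
have hy : (m (iy q) - lrow m <= m' (iy q))%N.
  by move/mnm_lepP: hle => /(_ (iy q)); rewrite mono_y ?zmon_zpart.
have hdeg := mdegD (zpart m' - zpart m) (zpart m); rewrite submK // in hdeg.
case: (ltnP (mdeg (zpart m)) (mdeg (zpart m'))) => hlt nz; first exact: Or32.
have z0 : (zpart m' - zpart m = 0)%MM by apply/eqP; rewrite -mdeg_eq0; lia.
have ez : zpart m' = zpart m by rewrite -(submK hz) z0 add0m.
have es : (m' - mono (zpart m) (m (ix q) - stair r t (lrow m)) (m (iy q) - lrow m))%MM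
   = mono 0 (m' (ix q) - (m (ix q) - stair r t (lrow m)))
       (m' (iy q) - (m (iy q) - lrow m)).
  apply/mnmP => i; rewrite mnmBE; case: (ixP i) => [->|->|hi].
  - by rewrite !mono_x ?zmon0 ?zmon_zpart.
  - by rewrite !mono_y ?zmon0 ?zmon_zpart.
  rewrite !monoE ge2_ix // ge2_iy // mnm0E -ez mnmE ltnNge hi /=; lia.
have hst : (stair r t (lrow m) <= m (ix q))%N.
  by move/mnm_lepP: (lead_le hm) => /(_ (ix q)); rewrite mono_x ?zmon0.
have hlm : (lrow m <= m (iy q))%N by exact: geq_minl.
rewrite es in nz; case: (pure_support (lrow_le m) nz) => [[e1 e2]|hlt'].
  apply: Or31; rewrite -(monoK m') -(monoK m) ez; congr (mono _ _ _); lia.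
by apply: Or33; split; [lia|lia].
Qed.

Definition expand (Q : S) : S := \sum_(m <- msupp Q) Q@_m *: multiple m.

Lemma expandwE k (Q : S) : (msize Q <= k)%N ->
  expand Q = \sum_(m : 'X_{1..q.+2 < k}) Q@_m *: multiple m.
Proof.
move=> hk; pose I : subFinType _ := 'X_{1..q.+2 < k}.
rewrite /expand (big_mksub I) ?msupp_uniq //=; first last.
  by move=> x /msize_mdeg_lt /leq_trans; apply.
by rewrite big_rmcond //= => j /memN_msupp_eq0 ->; rewrite scale0r.
Qed.

(** Lexicographic induction on the z-degree and the exponent of [y]: besides [multiple m], only
    multiples attached to smaller monomials can contain [m], and their coefficients in [Q] already
    vanish. *)
Lemma expand_eq0 (Q : S) : (forall m, ~~ inJ m -> Q@_m = 0) ->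
  (forall m, inJ m -> (expand Q)@_m = 0) -> Q = 0.
Proof.
move=> hQ hE; apply/mpolyP => m; rewrite mcoeff0.
have [d hd] := ubnP (mdeg (zpart m)); elim: d m hd => // d IHd m.
have [n hn] := ubnP (m (iy q)); elim: n m hn => // n IHn m hn hd.
have [hm|] := boolP (inJ m); last exact: hQ.
have [/eqP //|nz] := boolP (Q@_m == 0).
have := hE m hm; rewrite /expand raddf_sum (bigD1_seq m) ?msupp_uniq //=; last first.
  by rewrite mcoeff_msupp.
rewrite mcoeffZ multiple_lead // mulr1 big1 ?addr0 // => m' hm'.
rewrite mcoeffZ; have [hJ|/hQ->] := boolP (inJ m'); last by rewrite mul0r.
have [->|nz'] := eqVneq ((multiple m')@_m) 0; first by rewrite mulr0.
case: (multiple_support hJ nz') => [e'|hlt|[he hlt]].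
- by rewrite e' eqxx in hm'.
- by rewrite IHd ?mul0r //; apply: leq_trans hlt _.
by rewrite IHn ?mul0r // ?he //; apply: leq_trans hlt _.
Qed.

Definition expandable p := exists2 Q : S,
  (forall m, ~~ inJ m -> Q@_m = 0) & p = expand Q.

Lemma expandable0 : expandable 0.
Proof. by exists 0 => [m _|]; rewrite ?mcoeff0 // /expand msupp0 big_nil. Qed.

Lemma expandableD p1 p2 : expandable p1 -> expandable p2 -> expandable (p1 + p2).
Proof.
move=> [Q1 h1 ->] [Q2 h2 ->]; exists (Q1 + Q2).
  by move=> m hm; rewrite mcoeffD h1 // h2 // addr0.
pose k := maxn (msize (Q1 + Q2)) (maxn (msize Q1) (msize Q2)).
rewrite !(@expandwE k) ?leq_max ?leqnn ?orbT // -big_split /=.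
by apply: eq_bigr => m _; rewrite mcoeffD scalerDl.
Qed.

Lemma expandableZ a p : expandable p -> expandable (a *: p).
Proof.
move=> [Q h ->]; exists (a *: Q) => [m hm|]; first by rewrite mcoeffZ h ?mulr0.
pose k := maxn (msize (a *: Q)) (msize Q).
rewrite !(@expandwE k) ?leq_max ?leqnn ?orbT // scaler_sumr.
by apply: eq_bigr => m _; rewrite mcoeffZ scalerA.
Qed.

Lemma expandable_sum (I : Type) (s : seq I) (P : pred I) (f : I -> S) :
  (forall i, P i -> expandable (f i)) -> expandable (\sum_(i <- s | P i) f i).
Proof.
by move=> h; elim/big_ind: _ => //; [exact: expandable0 | exact: expandableD].
Qed.

Lemma expandable_lead (m : 'X_{1..q.+2}) j : (j <= r.+1)%N ->
  (m (iy q) == 0%N) || (j == r.+1) -> expandable ('X_[m] * H j).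
Proof.
move=> hj hm; pose m' := (m + lead j)%MM.
have ey : m' (iy q) = (m (iy q) + j)%N by rewrite mnmDE mono_y ?zmon0.
have ex : m' (ix q) = (m (ix q) + stair r t j)%N by rewrite mnmDE mono_x ?zmon0.
have el : lrow m' = j.
  rewrite /lrow ey; case/orP: hm => [/eqP -> | /eqP ->].
    by rewrite add0n; apply/minn_idPl.
  by apply/minn_idPr; rewrite leq_addl.
have hJ : inJ m'.
  rewrite /inJ ex ey; case/orP: hm => [/eqP -> | /eqP ->].
    by rewrite add0n leq_addl.
  by rewrite /stair; case: ltnP; lia.
exists 'X_[m'] => [m1 h1|].
  by rewrite mcoeffX; case: eqP => // e1; rewrite -e1 hJ in h1.
rewrite /expand msuppX big_seq1 mcoeffX eqxx scale1r /multiple el.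
by rewrite /m' addmK.
Qed.

(** The relations are used here. Rewriting [y H_j] brings in no new factor [y], since the entries
    involve only the z's; with a multiplier free of [y] all resulting terms are admissible
    multiples. *)
Lemma expandable_yM (m : 'X_{1..q.+2}) j : (j <= r)%N -> m (iy q) = 0%N ->
  expandable ('X_[m] * ('X_(iy q) * H j)).
Proof.
move=> hj hm; have := hrel hj; rewrite /syz => /eqP; rewrite subr_eq => /eqP ->.
rewrite mulrDr; apply: expandableD; last first.
  rewrite mulrnAr; case: (j.+1 != t); last exact: expandable0.
  rewrite mulr1n mulrA -mpolyXD; apply: expandable_lead => //.
  by rewrite mnmDE hm mnm1E.
rewrite mulr_sumr; apply: expandable_sum => i _.
rewrite /zpoly mulr_suml mulr_sumr; apply: expandable_sum => g _.
rewrite -scalerAl -scalerAr; have [hg|hg] := boolP (zmon (bmnm g)); last first.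
  by rewrite syzmx_zmon // scale0r; exact: expandable0.
apply: expandableZ; rewrite mulrA -mpolyXD; apply: expandable_lead.
  by rewrite -ltnS.
by rewrite mnmDE hm; case/andP: hg => _ ->.
Qed.

Lemma expandable_XM i p : expandable p -> expandable ('X_i * p).
Proof.
move=> [Q hQ ->]; rewrite /expand mulr_sumr; apply: expandable_sum => m _.
rewrite -scalerAr; have [hm|/hQ->] := boolP (inJ m); last first.
  by rewrite scale0r; exact: expandable0.
apply: expandableZ; rewrite /multiple.
have [hy|hy] := leqP (m (iy q)) r.
  have el : lrow m = m (iy q) by apply/minn_idPl/leqW.
  have e0 : (m - lead (lrow m))%MM (iy q) = 0%N.
    by rewrite mnmBE el mono_y ?zmon0 // subnn.
  have [->|hi] := eqVneq i (iy q).
    by rewrite mulrCA; apply: expandable_yM => //; rewrite el.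
  rewrite mulrA -mpolyXD; apply: expandable_lead; first exact: lrow_le.
  by rewrite mnmDE e0 mnm1E (negbTE hi).
rewrite mulrA -mpolyXD; apply: expandable_lead; first exact: lrow_le.
by rewrite /lrow (minn_idPr hy) eqxx orbT.
Qed.

Lemma expandable_M p j : (j <= r.+1)%N -> expandable (p * H j).
Proof.
move=> hj; rewrite [p]mpolyE mulr_suml; apply: expandable_sum => m _.
rewrite -scalerAl; apply: expandableZ.
have [d hd] := ubnP (mdeg m); elim: d m hd => // d IH m hd.
have [->|nz] := eqVneq m 0%MM.
  by apply: expandable_lead; rewrite // mnm0E.
have [i hi] : exists i, m i != 0%N.
  apply/existsP; apply: contraR nz; rewrite negb_exists => /forallP h.
  by apply/eqP/mnmP => i; rewrite mnm0E; apply/eqP; rewrite -[_ == _]negbK.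
have hle : (U_(i) <= m)%MM by rewrite lep1mP.
rewrite -(submK hle) addmC mpolyXD -mulrA; apply/expandable_XM/IH.
by have := mdegD (m - U_(i)) U_(i); rewrite submK // mdeg1; lia.
Qed.

(** This takes the place of Buchberger's criterion: it will force every complete reduction of an
    S-polynomial to vanish on the universal solution. *)
Lemma marked_basis_eq0 p : expandable p -> (forall m, inJ m -> p@_m = 0) -> p = 0.
Proof.
move=> [Q hQ ->] h; rewrite (expand_eq0 hQ h).
by rewrite /expand msupp0 big_nil.
Qed.

End Complement.

(** * Extension by the redundant generator *)

Section Extension.

Variables q r t : nat.
Hypothesis ht : (0 < t <= r.+1)%N.

Section OneRing.

Variable K : comNzRingType.
Local Notation S := {mpoly K[q.+2]}.
Implicit Types (H F a : nat -> S) (p : S) (e : nat -> nat -> 'X_{1..q.+2} -> K)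
  (c : nat -> nat -> K).

Definition zonly p := forall m, ~~ zmon m -> p@_m = 0.

Lemma zonly0 : zonly 0.
Proof. by move=> m _; rewrite mcoeff0. Qed.

Lemma zonlyD p p' : zonly p -> zonly p' -> zonly (p + p').
Proof. by move=> h h' m hm; rewrite mcoeffD h // h' // addr0. Qed.

Lemma zonlyN p : zonly p -> zonly (- p).
Proof. by move=> h m hm; rewrite mcoeffN h // oppr0. Qed.

Lemma zonlyZ k p : zonly p -> zonly (k *: p).
Proof. by move=> h m hm; rewrite mcoeffZ h // mulr0. Qed.

Lemma zonlyX g : zmon g -> zonly 'X_[g].
Proof. by move=> hg m hm; rewrite mcoeffX; case: eqP => // e'; rewrite -e' hg in hm. Qed.

Lemma zonlyXM g p : zmon g -> zonly p -> zonly ('X_[g] * p).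
Proof.
move=> hg hp m hm; rewrite mcoeffXM; case: ifP => // hle; apply: hp.
by apply: contra hm; rewrite -{2}(submK hle) zmonD => ->.
Qed.

Lemma zonly_zpoly (f : 'X_{1..q.+2} -> K) :
  (forall g, ~~ zmon g -> f g = 0) -> zonly (zpoly f).
Proof.
move=> hf m hm; have [h|h] := ltnP (mdeg m) 3; last exact: mcoeff_zpoly_ge.
by rewrite mcoeff_zpoly // hf.
Qed.

Lemma mcoeff_zonlyM p H j z x b : zonly p -> markedj r t H j -> zmon z ->
  (stair r t b <= x)%N ->
  (p * H j)@_(mono z x b) = p@_z *+ ((x == stair r t j) && (b == j)).
Proof.
move=> hp hH hz hb; rewrite [in LHS](mpolyE p) mulr_suml raddf_sum /=.
rewrite [in RHS](mpolyE p) raddf_sum /= -sumrMnl; apply: eq_bigr => m _.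
rewrite -scalerAl !mcoeffZ mcoeffX; have [hm|/hp->] := boolP (zmon m); last first.
  by rewrite !mul0r mul0rn.
rewrite mcoeff_zM // -mulrnAr; congr (_ * _); case: ifP => hle; last first.
  by case: (m =P z) => [e'|_]; rewrite ?mul0rn // e' lepm_refl in hle *.
have [_ h] := hH (z - m)%MM x b (zmonB m hz); rewrite h //.
have -> : ((z - m)%MM == 0%MM) = (m == z).
  apply/eqP/eqP => [e'|->]; first by rewrite -(submK hle) e' add0m.
  by apply/mnmP => i; rewrite mnmBE subnn mnm0E.
by case: (m == z) => /=; case: (_ && _); rewrite ?mul0rn ?mulr0n ?mulr1n.
Qed.

(** Coefficients in the z's of a combination of the [H j] can be read off at the multiples of the
    [lead j], hence are unique. *)
Lemma mcoeff_zsum a H z x b : (forall j, zonly (a j)) -> marked r t H ->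
  zmon z -> (stair r t b <= x)%N ->
  (\sum_(j < r.+2) a j * H j)@_(mono z x b) =
  (a b)@_z *+ ((x == stair r t b) && (b <= r.+1)%N).
Proof.
move=> ha hH hz hb; rewrite raddf_sum /=.
have E (j : 'I_r.+2) : (a j * H j)@_(mono z x b) =
    (a j)@_z *+ ((x == stair r t j) && (b == j)).
  by apply: mcoeff_zonlyM => //; apply: hH; rewrite -ltnS.
rewrite (eq_bigr _ (fun j _ => E j)); case: (leqP b r.+1) => hbr.
  rewrite (bigD1 (Ordinal (hbr : (b < r.+2)%N))) //= eqxx big1 ?addr0 // => j /eqP hj.
  rewrite (_ : (b == j) = false) ?andbF //; apply/eqP => e'; apply: hj; exact: val_inj.
rewrite andbF big1 // => j _; rewrite (_ : (b == j) = false) ?andbF //.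
by have := ltn_ord j; lia.
Qed.

(** Any coefficients in the z's will do: being unique, they are the [syzcoef], whose shape is given
    by [syzcoefE]. *)
Lemma syzrel_of_span H : marked r t H ->
  (forall i, (i <= r)%N -> exists2 a : nat -> S, forall j, zonly (a j) &
     syz t H i = \sum_(j < r.+2) a j * H j) ->
  syzrel r t (syzmx r t (topcoef r H) (syzcoef r t H)) H.
Proof.
move=> hH hspan i hi; have [a ha E] := hspan i hi; rewrite E.
apply: eq_bigr => j _; congr (_ * _); apply/mpolyP => m.
have hj : (j <= r.+1)%N by rewrite -ltnS.
have [hm|hm] := boolP (zmon m); last first.
  by rewrite ha // zonly_zpoly // => g hg; exact: syzmx_zmon.
have -> : (a j)@_m = syzcoef r t H i j m.
  by rewrite /syzcoef E (mcoeff_zsum ha hH hm (leqnn _)) eqxx hj.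
(* Beyond degree 2 the coefficient vanishes by homogeneity, so the truncation in [zpoly] loses
   nothing. *)
have [hm3|hm3] := ltnP (mdeg m) 3; first by rewrite mcoeff_zpoly // -syzcoefE.
rewrite mcoeff_zpoly_ge //; apply: (syz_homog ht hi hH) => //.
by rewrite -addnA stairD // /rowdeg; case: ifP; case: ifP; lia.
Qed.

Lemma syzcoef_syzrel c e H i j z : marked r t H ->
  syzrel r t (syzmx r t c e) H -> (i <= r)%N -> (j <= r.+1)%N -> zmon z ->
  syzcoef r t H i j z = syzmx r t c e i j z.
Proof.
move=> hH hrel hi hj hz; rewrite /syzcoef hrel //.
have hz' j' : zonly (zpoly (syzmx r t c e i j')).
  by apply: zonly_zpoly => g; exact: syzmx_zmon.
rewrite (mcoeff_zsum hz' hH hz (leqnn _)) eqxx hj /= mulr1n.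
have [h|h] := ltnP (mdeg z) 3; first by rewrite mcoeff_zpoly.
by rewrite mcoeff_zpoly_ge // syzmx_deg // /rowdeg; case: ifP; case: ifP; lia.
Qed.

Definition ext_coef F j (g : 'X_{1..q.+2}) : K :=
  if zmon g then ('X_(iy q) * F t.-1)@_(mono g (stair r t j) j) else 0.

(* [lead t = y * lead t.-1] is not a minimal generator; the corresponding
   entry is the reduction of [y * F t.-1]. *)
Definition extend F j : S :=
  if j == t then
    'X_(iy q) * F t.-1 - \sum_(i < r.+2 | i != t :> nat) zpoly (ext_coef F i) * F i
  else F j.

Lemma extendN F j : j != t -> extend F j = F j.
Proof. by rewrite /extend => /negbTE->. Qed.

Lemma ext_coef_zonly F j : zonly (zpoly (ext_coef F j)).
Proof. by apply: zonly_zpoly => g /negbTE; rewrite /ext_coef => ->. Qed.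

Definition premarked F :=
  forall j, (j <= r.+1)%N -> j != t -> markedj r t F j.

(** Every monomial of the ideal in [y * F t.-1] is a z-multiple of some [lead j]. One subtraction
    removes those with [j != t], because the z-multiples of the [F i] bring in no other monomial of
    the ideal. *)
Lemma extend_marked F : premarked F -> marked r t (extend F).
Proof.
move=> hF j hj; have [->|hjt] := eqVneq j t; last first.
  by move=> z x b hz; rewrite extendN //; exact: (hF j hj hjt).
have hp : (t.-1 <= r.+1)%N by lia.
have hpt : t.-1 != t by lia.
have rt : rowdeg r t t = r.+1 by rewrite /rowdeg ltnn.
have rp : rowdeg r t t.-1 = r by rewrite /rowdeg ifT //; lia.
have hom z x b : zmon z -> (mdeg z + x + b != r.+1)%N ->
    ('X_(iy q) * F t.-1)@_(mono z x b) = 0.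
  move=> hz hd; rewrite mcoeff_yM //; case: b hd => // b hd.
  by apply: (hF _ hp hpt z x b hz).1; rewrite rp; lia.
move=> z x b hz; rewrite /extend eqxx rt mcoeffB raddf_sum /=; split=> [hd|hs].
  rewrite hom // sub0r big1 ?oppr0 // => i hi.
  rewrite mcoeff_zpolyM //; last by move=> g /negbTE; rewrite /ext_coef => ->.
  apply: big1 => g hg; rewrite /ext_coef.
  have [hgz|_] := boolP (zmon _); last by rewrite mul0r.
  have hir : (i <= r.+1)%N by rewrite -ltnS.
  have [hdg|hdg] := eqVneq (mdeg (bmnm g) + rowdeg r t i)%N r.+1; last first.
    by rewrite hom ?mul0r // -addnA stairD.
  rewrite (hF i hir hi _ _ _ (zmonB (bmnm g) hz)).1 ?mulr0 //.
  by have := mdegD (z - bmnm g) (bmnm g); rewrite submK //; lia.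
have E (i : 'I_r.+2) : i != t :> nat ->
    (zpoly (ext_coef F i) * F i)@_(mono z x b) =
    (zpoly (ext_coef F i))@_z *+ ((x == stair r t i) && (b == i)).
  move=> hi; apply: mcoeff_zonlyM => //; first exact: ext_coef_zonly.
  by apply: hF => //; rewrite -ltnS.
rewrite (eq_bigr _ (fun i hi => E i hi)).
have -> : \sum_(i < r.+2 | i != t :> nat)
      (zpoly (ext_coef F i))@_z *+ ((x == stair r t i) && (b == i)) =
    (if [&& b != t, (b <= r.+1)%N & x == stair r t b]
     then ('X_(iy q) * F t.-1)@_(mono z x b) else 0).
  case: ifP => [/and3P[hbt hbr /eqP ->]|hn].
    rewrite (bigD1 (Ordinal (hbr : (b < r.+2)%N))) //= !eqxx mulr1n big1 ?addr0.
      have [h|h] := ltnP (mdeg z) 3; first by rewrite mcoeff_zpoly // /ext_coef hz.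
      rewrite mcoeff_zpoly_ge // hom // -addnA stairD // /rowdeg; case: ifP; lia.
    move=> i /andP[_ /eqP hi]; rewrite (_ : (b == i) = false) ?andbF //.
    by apply/eqP => e'; apply: hi; exact: val_inj.
  apply: big1 => i hi; case: andP => // -[hx /eqP hb].
  by move: hn; rewrite hb hi hx -ltnS ltn_ord.
rewrite mcoeff_yM //; case: b hs {E} => [|b] hs.
  by rewrite if_same subr0 [0%N == t]eq_sym (_ : (t == 0%N) = false) ?andbF //; lia.
have [_ hm] := hF _ hp hpt z x b hz.
have st : stair r t t = (r.+1 - t)%N by rewrite /stair ltnn.
have sp : stair r t t.-1 = (r.+1 - t)%N by rewrite /stair ifT; lia.
have eb : (b == t.-1) = (b.+1 == t) by lia.
case: (leqP (stair r t b) x) => hbx.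
  rewrite hm // sp -eb st; case: ifP => [/and3P[hbt hbr hx]|_]; last by rewrite subr0.
  by rewrite subrr; move: hbt; move=> /negbTE->; rewrite !andbF.
(* A tail monomial that [y] moves into the ideal lands exactly on the staircase, which descends by
   at most one at each step. *)
have [hbr ->] : (b.+1 <= r.+1)%N /\ x = stair r t b.+1.
  by move: hs hbx; rewrite /stair; case: (ltnP b t); case: (ltnP b.+1 t); lia.
have hbt : b.+1 != t.
  apply: contraTneq hbx => ebt; rewrite -leqNgt; move: hs.
  by rewrite /stair ebt ltnn leqnn; lia.
by rewrite hbt hbr !eqxx /= subrr (negbTE hbt) !andbF.
Qed.

Lemma syz_extend F : premarked F ->
  exists2 a : nat -> S, forall j, zonly (a j) &
    syz t (extend F) t.-1 = \sum_(j < r.+2) a j * extend F j.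
Proof.
move=> hF; exists (fun j => if j == t then 1 else zpoly (ext_coef F j)).
  move=> j; case: ifP => _; last exact: ext_coef_zonly.
  by rewrite -mpolyX0; apply: zonlyX; exact: zmon0.
rewrite /syz prednK; last by lia.
rewrite eqxx mulr0n subr0 extendN; last by lia.
have htr : (t < r.+2)%N by lia.
rewrite (bigD1 (Ordinal htr)) //= eqxx mul1r {1}/extend eqxx.
rewrite [X in _ = _ + X](eq_bigl (fun i : 'I_r.+2 => i != t :> nat)) //.
rewrite [X in _ = _ + X](eq_bigr (fun i : 'I_r.+2 => zpoly (ext_coef F i) * F i)).
  by rewrite subrK.
by move=> i hi; rewrite (negbTE hi) extendN.
Qed.

(** The pivot relation expresses [H t] by the other rows just as [extend] does, so a solution can be
    recovered from its minimal generators. *)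
Lemma extend_id c e H : marked r t H -> syzrel r t (syzmx r t c e) H ->
  forall j, extend H j = H j.
Proof.
move=> hH hrel j; rewrite /extend; case: eqP => // ->.
have hp : (t.-1 <= r)%N by lia.
have htr : (t < r.+2)%N by lia.
have := hrel _ hp; rewrite /syz prednK; last by lia.
rewrite eqxx mulr0n subr0 => ->; rewrite (bigD1 (Ordinal htr)) //=.
have -> : zpoly (syzmx r t c e t.-1 t) = 1.
  apply/mpolyP => m; rewrite mcoeff1; have [->|nz] := eqVneq m 0%MM.
    by rewrite mcoeff_zpoly ?mdeg0 // syzmx_pivot.
  have [h|h] := ltnP (mdeg m) 3; last by rewrite mcoeff_zpoly_ge.
  rewrite mcoeff_zpoly // syzmx_deg //.
  have : mdeg m != 0%N by rewrite mdeg_eq0.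
  by rewrite /rowdeg ltnn ifT; lia.
rewrite mul1r [X in _ - X](eq_bigl (fun i => i != Ordinal htr)) //.
rewrite [X in _ - X](eq_bigr (fun i : 'I_r.+2 => zpoly (syzmx r t c e t.-1 i) * H i)).
  by rewrite addrK.
move=> i hi; congr (_ * _); apply: eq_bigr => g _; congr (_ *: _).
rewrite /ext_coef; case: ifP => [hg|/negbT hg]; last by rewrite syzmx_zmon.
have hir : (i <= r.+1)%N by rewrite -ltnS.
rewrite -(syzcoef_syzrel hH hrel hp hir hg) /syzcoef /syz prednK; last by lia.
by rewrite eqxx mulr0n subr0.
Qed.

End OneRing.

(** * Base change along a ring morphism *)

Section Naturality.

Variables (K L : comNzRingType) (f : {rmorphism K -> L}).
Implicit Types (H F : nat -> {mpoly K[q.+2]}).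
Local Notation mapf := (map_mpoly f).

Lemma map_zpoly u : mapf (zpoly u) = zpoly (fun g => f (u g)) :> {mpoly L[q.+2]}.
Proof.
by rewrite /zpoly rmorph_sum; apply: eq_bigr => g _; rewrite /= map_mpolyZ map_mpolyX.
Qed.

Lemma map_syz H i : mapf (syz t H i) = syz t (fun j => mapf (H j)) i.
Proof. by rewrite /syz rmorphB rmorphMn !rmorphM /= !map_mpolyX. Qed.

Lemma map_syzcoef H i j z :
  f (syzcoef r t H i j z) = syzcoef r t (fun j => mapf (H j)) i j z.
Proof. by rewrite /syzcoef -map_syz mcoeff_map_mpoly. Qed.

Lemma map_topcoef H i j : f (topcoef r H i j) = topcoef r (fun j => mapf (H j)) i j.
Proof. by rewrite /topcoef mcoeff_map_mpoly. Qed.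

Lemma map_markedj H j : markedj r t H j -> markedj r t (fun j => mapf (H j)) j.
Proof.
move=> hH z a b hz; have [h0 h1] := hH z a b hz; rewrite mcoeff_map_mpoly.
by split=> [/h0->|/h1->]; [exact: rmorph0|exact: rmorph_nat].
Qed.

Lemma map_telescope u m i : f (telescope u m i) = telescope (fun i m => f (u i m)) m i.
Proof.
elim: m i => [|m IH] i /=; first by rewrite rmorphB rmorph0.
by rewrite rmorphB IH.
Qed.

Lemma map_syzmx c e i j z :
  f (syzmx r t c e i j z) =
  syzmx (q := q) r t (fun i j => f (c i j)) (fun i j z => f (e i j z)) i j z.
Proof.
have ftop i' j' : f (toprow r t c i' j') = toprow r t (fun i j => f (c i j)) i' j'.
  rewrite /toprow; case: ifP => _; first by rewrite rmorph_nat.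
  by case: ifP => _ //; rewrite rmorph0.
rewrite /syzmx; case: ifP => _; first by rewrite rmorph0.
case: ifP => _ //; case: ifP => _; first by rewrite rmorphB rmorphMn !ftop.
by case: ifP => _ //; case: j => [|j]; rewrite ?rmorph0 // map_telescope.
Qed.

Lemma map_syzrel c e H : syzrel r t (syzmx r t c e) H ->
  syzrel r t (syzmx r t (fun i j => f (c i j)) (fun i j z => f (e i j z)))
    (fun j => mapf (H j)).
Proof.
move=> hH i hi; rewrite -map_syz hH // rmorph_sum; apply: eq_bigr => j _.
rewrite rmorphM /= map_zpoly; congr (_ * _); apply: eq_bigr => g _.
by rewrite map_syzmx.
Qed.

Lemma map_extend F j : mapf (extend F j) = extend (fun j => mapf (F j)) j.
Proof.
rewrite /extend; case: eqP => // _.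
rewrite rmorphB rmorphM /= map_mpolyX rmorph_sum; congr (_ - _).
apply: eq_bigr => i _; rewrite rmorphM /= map_zpoly; congr (_ * _).
apply: eq_bigr => g _; congr (_ *: _); rewrite /ext_coef; case: ifP => _.
  by rewrite -mcoeff_map_mpoly rmorphM /= map_mpolyX.
by rewrite rmorph0.
Qed.

End Naturality.

Lemma eq_syzmx (K : comNzRingType) (c c' : nat -> nat -> K)
    (e e' : nat -> nat -> 'X_{1..q.+2} -> K) :
  (forall i j, (i < t)%N -> (t <= j <= r)%N -> c i j = c' i j) ->
  (forall i j z, free_index r t i j z -> e i j z = e' i j z) ->
  forall i j z, (i <= r)%N -> (j <= r.+1)%N ->
  syzmx r t c e i j z = syzmx r t c' e' i j z.
Proof.
move=> hc he i j z hi hj.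
have htop i' j' : (i' < t)%N -> toprow r t c i' j' = toprow r t c' i' j'.
  move=> hi'; rewrite /toprow; case: ltnP => // h1; case: ifP => // h2.
  by apply: hc; rewrite // h1 h2.
rewrite /syzmx; case: (boolP (zmon z)) => //= hz; case: eqP => //= hd.
case: ltnP => hit; last first.
  by apply: he; rewrite /free_index hi hj hz hd eqxx (ltnNge i t) hit /=; lia.
case: leqP => hjt.
  rewrite htop //; congr (_ - _); case: eqP => hit'; rewrite ?mulr0n // !mulr1n.
  by apply: htop; lia.
case: eqP => hit'; last first.
  by apply: he; rewrite /free_index hi hj hz hd eqxx hjt implybT andbT /= andbT; apply/eqP.
case: j hj hjt hd => // j hj hjt hd.
have hd1 : mdeg z = 1%N by move: hd; rewrite /rowdeg hit hjt; lia.
have {hd hi hj}: (j < i < t)%N by lia.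
(* For [m < i < t], [telescope] visits only entries in rows below [t.-1] and columns below [t], all
   of them free. *)
elim: j i hjt {hit hit'} => [|m IH] [|i] // hmt hmi /=.
  congr (_ - _); apply: he; rewrite /free_index hz /rowdeg hd1.
  by rewrite !ifT ?eqxx; lia.
rewrite IH; [|lia|lia]; congr (_ - _); apply: he.
by rewrite /free_index hz /rowdeg hd1 !ifT ?eqxx; lia.
Qed.

End Extension.

(** * The generators of the ideal and the marked family *)

Section Generators.

Variables q r t : nat.
Hypothesis ht : (0 < t <= r.+1)%N.
Local Notation G := (Rgens q.+1 r t).
Local Notation prec := (@revlex q.+2).
Local Notation lead := (@lead q r t).
Local Notation inJ := (@inJ q r t).

Lemma stair_bump i : (i <= r)%N -> stair r t (bump t i) = (r - i)%N.
Proof. by rewrite /stair /bump => hi; case: (leqP t i) => h; case: ltnP; lia. Qed.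

Lemma bump_le i : (i <= r)%N -> (bump t i <= r.+1)%N.
Proof. by rewrite /bump => hi; case: leqP; lia. Qed.

Lemma neq_bump_t i : bump t i != t.
Proof. by rewrite eq_sym neq_bump. Qed.

(** The shift [delta_i] amounts to skipping the redundant index [t], which is what [bump t] does. *)
Lemma RgensE : G = [seq lead (bump t i) | i <- iota 0 r.+1].
Proof.
apply/eq_in_map => i; rewrite mem_iota add0n ltnS => /andP[_ hi].
apply/mnmP => l; rewrite mnmE.
have -> : lead (bump t i) = mono 0 (stair r t (bump t i)) (bump t i) by [].
case: (ixP l) => [->|->|hl].
- by rewrite mono_x ?zmon0 // stair_bump.
- by rewrite mono_y ?zmon0 //= /bump addnC.
by rewrite monoE ge2_ix // ge2_iy // mnm0E; case: l hl => -[|[|l]].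
Qed.

Lemma lead_leE j m : (lead j <= m)%MM = (stair r t j <= m (ix q))%N && (j <= m (iy q))%N.
Proof.
have -> : lead j = mono 0 (stair r t j) j by [].
apply/mnm_lepP/andP => [h|[h1 h2] i].
  by move: (h (ix q)) (h (iy q)); rewrite mono_x ?mono_y ?zmon0.
case: (ixP i) => [->|->|hi]; rewrite ?mono_x ?mono_y ?zmon0 //.
by rewrite monoE ge2_ix // ge2_iy // mnm0E.
Qed.

Lemma stair_anti i j : (i <= j)%N -> (stair r t j <= stair r t i)%N.
Proof. by rewrite /stair; case: (ltnP i t); case: (ltnP j t); lia. Qed.

Lemma in_monidealE m : in_monideal G m = inJ m.
Proof.
rewrite /in_monideal RgensE has_map /inJ; apply/hasP/idP => [[i]|h].
  rewrite mem_iota add0n ltnS /= => hi; rewrite lead_leE => /andP[h1 h2].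
  exact: leq_trans (stair_anti h2) h1.
pose j := minn (m (iy q)) r.+1.
have hj : (j <= r.+1)%N by exact: geq_minr.
have hjm : (j <= m (iy q))%N by exact: geq_minl.
have hs : (stair r t j <= m (ix q))%N.
  move: h; rewrite /j; case: (leqP (m (iy q)) r.+1) => // h _.
  by rewrite /stair; case: ltnP; lia.
(* This inverts [bump t] away from [t]; at [j = t] it yields [t.-1], whose leading monomial divides
   [lead t]. *)
exists (if (j < t)%N then j else j.-1).
  by rewrite mem_iota add0n ltnS; case: ifP; lia.
rewrite /= lead_leE; case: ifP => hjt.
  by rewrite (_ : bump t j = j) ?hs ?hjm // /bump leqNgt hjt.
have [ejt|njt] := eqVneq j t; last first.
  by rewrite (_ : bump t j.-1 = j) ?hs ?hjm // /bump (_ : (t <= j.-1)%N); lia.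
have -> : bump t j.-1 = t.-1 by rewrite /bump ejt (_ : (t <= t.-1)%N = false); lia.
apply/andP; split; last by lia.
by move: hs; rewrite ejt /stair ltnn (_ : (t.-1 < t)%N); lia.
Qed.

Lemma lead_le_lead i j : i != t -> j != t -> (i <= r.+1)%N -> (j <= r.+1)%N ->
  (lead i <= lead j)%MM = (i == j).
Proof.
move=> hi hj hi' hj'; rewrite lead_leE.
have -> : lead j = mono 0 (stair r t j) j by [].
rewrite mono_x ?mono_y ?zmon0 // /stair.
by case: (ltnP i t); case: (ltnP j t); lia.
Qed.

Lemma lead_inj : injective lead.
Proof.
move=> i j; have E k : lead k = mono 0 (stair r t k) k by [].
by move/(congr1 (fun m => fun_of_multinom m (iy q))); rewrite !E !mono_y ?zmon0.
Qed.

Lemma mingensE : mingens G = G.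
Proof.
rewrite /mingens (_ : [seq a <- G | _] = G).
  rewrite undup_id // RgensE map_inj_uniq ?iota_uniq // => i j /lead_inj.
  by rewrite /bump; case: leqP; case: leqP; lia.
apply/all_filterP/allP => a ha; apply/allP => b hb; apply/implyP; move: ha hb.
rewrite RgensE => /mapP[i hi ->] /mapP[j hj ->].
move: hi hj; rewrite !mem_iota !add0n !ltnS /= => hi hj.
by rewrite lead_le_lead ?neq_bump_t ?bump_le // => /eqP->.
Qed.

Lemma size_mingens : size (mingens G) = r.+1.
Proof. by rewrite mingensE size_map size_iota. Qed.

Definition gen i : gen_index G := cast_ord (esym size_mingens) (inord i).

Lemma genK (i : gen_index G) : gen i = i.
Proof.
apply: val_inj; rewrite /= inordK //; apply: leq_trans (ltn_ord i) _.
by rewrite size_mingens.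
Qed.

Lemma val_gen i : (i <= r)%N -> gen i = i :> nat.
Proof. by move=> hi; rewrite /= inordK. Qed.

Lemma gen_le (i : gen_index G) : (i <= r)%N.
Proof. by rewrite -ltnS; apply: leq_trans (ltn_ord i) _; rewrite size_mingens. Qed.

Lemma mingenE (i : gen_index G) : mingen i = lead (bump t i).
Proof.
have hi := gen_le i; rewrite /mingen (tnth_nth 0%MM) /=.
have -> : nth 0%MM (mingens G) i = nth 0%MM [seq lead (bump t i) | i <- iota 0 r.+1] i.
  by apply: (congr1 (fun s => nth 0%MM s (nat_of_ord i))); rewrite mingensE RgensE.
by rewrite (nth_map 0%N) ?size_iota ?nth_iota.
Qed.

Lemma mdeg_lead j : (j <= r.+1)%N -> mdeg (lead j) = rowdeg r t j.
Proof. by move=> hj; rewrite mdeg_mono mdeg0 add0n stairD. Qed.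

(** The order enters only here. If some z occurs in [m], the last one makes [m] smaller, as the
    generators are z-free. Otherwise [m] lies outside the ideal in the same degree and has a larger
    exponent of [y]. *)
Lemma tailE (i : gen_index G) m :
  tail prec i m = (mdeg m == rowdeg r t (bump t i)) && ~~ inJ m.
Proof.
have hi := gen_le i; have hb := bump_le hi.
have -> : tail prec i m = [&& prec m (mingen i) & mdeg m == mdeg (mingen i)]
  && ~~ in_monideal G m by [].
rewrite in_monidealE mingenE mdeg_lead //.
have [hd|_] := eqVneq; last by rewrite andbF.
rewrite andbT; have [|hm] := boolP (inJ m); first by rewrite !andbF.
rewrite !andbT /revlex mdeg_lead // hd ltnn eqxx /=; apply/existsP.
have E : lead (bump t i) = mono 0 (stair r t (bump t i)) (bump t i) by [].
have [/existsP[l0 hl0]|hz] := boolP [exists l : 'I_q.+2, (2 <= l)%N && (m l != 0%N)].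
  have [l /andP[hl1 hl2] hmax] :=
    @arg_maxnP _ l0 (fun l : 'I_q.+2 => (2 <= l)%N && (m l != 0%N)) (@nat_of_ord _) hl0.
  exists l; rewrite E monoE ge2_ix // ge2_iy // mnm0E lt0n hl2 /=.
  apply/forallP => l'; apply/implyP => hll.
  have hl' : (2 <= l')%N by apply: leq_trans hl1 (ltnW hll).
  rewrite monoE ge2_ix // ge2_iy // mnm0E eq_sym; apply: contraLR hll => nz.
  by rewrite -leqNgt; apply: hmax; rewrite hl' nz.
have hz' (l : 'I_q.+2) : (2 <= l)%N -> m l = 0%N.
  move: hz; rewrite negb_exists => /forallP /(_ l); rewrite negb_and negbK => h hl.
  by move: h; rewrite hl => /eqP.
exists (iy q); apply/andP; split; last first.
  apply/forallP => l; apply/implyP => hl; have hl2 : (2 <= l)%N by exact: hl.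
  by rewrite hz' // E monoE ge2_ix // ge2_iy // mnm0E.
rewrite E mono_y ?zmon0 //.
have z0 : zpart m = 0%MM.
  by apply/mnmP => l; rewrite mnmE mnm0E; case: ltnP => // /hz'.
move: hd hm; rewrite -{1}(monoK m) mdeg_mono z0 mdeg0 add0n /inJ /rowdeg /stair.
move: hb; rewrite /bump; case: (leqP t i) => hit /=.
  by case: (ltnP (1 + i) t); case: (ltnP (m (iy q)) t); lia.
by case: (ltnP (0 + i) t); case: (ltnP (m (iy q)) t); lia.
Qed.

Variable k : fieldType.
Local Notation F := (@marked_family k _ prec G).

Lemma deg_boundP (i : gen_index G) m : tail prec i m -> (mdeg m < deg_bound G)%N.
Proof.
rewrite tailE => /andP[/eqP hd _]; rewrite ltnS hd -mdeg_lead ?bump_le ?gen_le //.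
rewrite -mingenE; apply: (@leq_bigmax_seq _ _ xpredT (fun a => mdeg a)) => //.
exact: mem_tnth.
Qed.

Lemma mcoeff_marked (c : coef_index prec G) :
  (F (val c).1)@_(bmnm (val c).2) = 'X_(enum_rank c).
Proof.
have := valP c; set i := (val c).1; set m := bmnm _ => hm.
rewrite /marked_family mcoeffD mcoeffX.
have -> : (mingen i == m) = false.
  apply/eqP => e; move: hm; rewrite tailE -e mingenE /inJ.
  have -> : lead (bump t i) = mono 0 (stair r t (bump t i)) (bump t i) by [].
  by rewrite mono_x ?mono_y ?zmon0 // leqnn andbF.
rewrite add0r raddf_sum (bigD1 c) //= mcoeffZ mcoeffX eqxx mulr1 big1 ?addr0 //.
move=> c' /andP[/eqP hc' nc]; rewrite mcoeffZ mcoeffX.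
case: eqP => [e|_]; last by rewrite mulr0.
case/negP: nc; apply/eqP/val_inj; rewrite [LHS]surjective_pairing.
by rewrite [RHS]surjective_pairing hc'; congr (_, _); apply/eqP; rewrite bmeqP e.
Qed.

Lemma mcoeff_marked_notin (i : gen_index G) m : ~~ tail prec i m ->
  (F i)@_m = (m == mingen i)%:R.
Proof.
move=> hm; rewrite /marked_family mcoeffD mcoeffX eq_sym raddf_sum big1 ?addr0 //.
move=> c /eqP hc /=; rewrite mcoeffZ mcoeffX; case: eqP => [e|_]; last by rewrite mulr0.
by have := valP c; rewrite e hc (negbTE hm).
Qed.

Lemma tail_coef_index (i : gen_index G) m : tail prec i m ->
  exists c : coef_index prec G, (val c).1 = i /\ bmnm (val c).2 = m.
Proof.
move=> hm; have hb := deg_boundP hm.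
by exists (exist (fun c => tail prec c.1 (bmnm c.2)) (i, BMultinom hb) hm).
Qed.

(** The value at [t] has no meaning; [extend] replaces it. *)
Definition stratum_family j := F (gen (unbump t j)).

Lemma stratum_family_bump (i : gen_index G) : stratum_family (bump t i) = F i.
Proof. by rewrite /stratum_family bumpK genK. Qed.

End Generators.

(** * Reduction of S-polynomials *)

Section Support.

Variables q r t : nat.
Hypothesis ht : (0 < t <= r.+1)%N.
Local Notation inJ := (@inJ q r t).
Local Notation stair := (stair r t).

(* Exponents [(a, b)] of [x] and [y] in [lead j] times a monomial in the z's,
   respectively in [y * lead j] times such a monomial for [j] not [t.-1], [t]. *)
Definition corner a b := (a == stair b) && (b <= r.+1)%N.

Definition next_corner a b :=
  [&& (0 < b)%N, a == stair b.-1, (b.-1 <= r.+1)%N, b.-1 != t.-1 & b.-1 != t].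

Section OneRing.

Variable K : comNzRingType.
Local Notation S := {mpoly K[q.+2]}.
Implicit Types (p : S) (H : nat -> S) (P : nat -> nat -> bool).

(** Only monomials of the ideal can be reduced, so a bound on these controls which multiples of the
    generators a reduction may subtract. *)
Definition jsupp P p := forall z a b, zmon z -> (stair b <= a)%N ->
  p@_(mono z a b) != 0 -> P a b.

Lemma jsuppS P P' p : (forall a b, P a b -> P' a b) -> jsupp P p -> jsupp P' p.
Proof. by move=> h hp z a b hz hab nz; apply/h/(hp z). Qed.

Lemma jsupp0 P : jsupp P 0.
Proof. by move=> z a b _ _; rewrite mcoeff0 eqxx. Qed.

Lemma jsuppD P p p' : jsupp P p -> jsupp P p' -> jsupp P (p + p').
Proof.
move=> h h' z a b hz hab; rewrite mcoeffD.
have [->|nz] := eqVneq p@_(mono z a b) 0; first by rewrite add0r; exact: h'.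
by move=> _; exact: h nz.
Qed.

Lemma jsuppZ P c p : jsupp P p -> jsupp P (c *: p).
Proof.
move=> h z a b hz hab; rewrite mcoeffZ.
have [->|nz] := eqVneq p@_(mono z a b) 0; first by rewrite mulr0 eqxx.
by move=> _; exact: h nz.
Qed.

Lemma jsuppN P p : jsupp P p -> jsupp P (- p).
Proof. by rewrite -scaleN1r; exact: jsuppZ. Qed.

Lemma jsupp_sum P (I : Type) (s : seq I) (Q : pred I) (f : I -> S) :
  (forall i, Q i -> jsupp P (f i)) -> jsupp P (\sum_(i <- s | Q i) f i).
Proof. by move=> h; elim/big_ind: _ => //; [exact: jsupp0 | exact: jsuppD]. Qed.

Lemma jsupp_zX P g p : zmon g -> jsupp P p -> jsupp P ('X_[g] * p).
Proof.
move=> hg hp z a b hz hab; rewrite mcoeff_zM //; case: ifP => [_|]; last by rewrite eqxx.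
by apply: hp => //; exact: zmonB.
Qed.

Lemma jsupp_zonly P p p' : zonly p -> jsupp P p' -> jsupp P (p * p').
Proof.
move=> hp hp'; rewrite [p]mpolyE mulr_suml; apply: jsupp_sum => g _.
rewrite -scalerAl; have [hg|/hp->] := boolP (zmon g); first exact/jsuppZ/jsupp_zX.
by rewrite scale0r; exact: jsupp0.
Qed.

Lemma jsupp_markedj H j : (j <= r.+1)%N -> markedj r t H j -> jsupp corner (H j).
Proof.
move=> hj hH z a b hz hab; rewrite (hH z a b hz).2 // /corner.
by case: and3P => [[_ /eqP-> /eqP->] _|]; rewrite ?eqxx.
Qed.

Lemma jsupp_yM H j : markedj r t H j ->
  jsupp (fun a b => corner a b || ((a == stair j) && (b == j.+1)))
    ('X_(iy q) * H j).
Proof.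
move=> hH z a b hz hab; rewrite mcoeff_yM //; case: b hab => [|b] hab; first by rewrite eqxx.
have [hb|hb] := leqP (stair b) a.
  rewrite (hH z a b hz).2 // eqSS.
  by case: and3P => [[_ -> ->]|]; rewrite ?orbT ?eqxx.
move=> _; apply/orP; left; rewrite /corner; move: hab hb; rewrite /stair.
by case: (ltnP b t); case: (ltnP b.+1 t); lia.
Qed.

Lemma jsupp_xM H j : markedj r t H j ->
  jsupp (fun a b => corner a b || ((a == (stair j).+1) && (b == j)))
    ('X_(ix q) * H j).
Proof.
move=> hH z a b hz hab; rewrite mcoeff_xM //; case: a hab => [|a] hab; first by rewrite eqxx.
have [hb|hb] := leqP (stair b) a.
  rewrite (hH z a b hz).2 // eqSS.
  by case: and3P => [[_ -> ->]|]; rewrite ?orbT ?eqxx.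
move=> _; apply/orP; left; rewrite /corner; move: hab hb; rewrite /stair.
by case: (ltnP b t); lia.
Qed.

Lemma stairS j : (j <= r)%N -> j.+1 != t -> stair j = (stair j.+1).+1.
Proof. by rewrite /stair; case: (ltnP j t); case: (ltnP j.+1 t); lia. Qed.

Lemma stair_pivot : stair t.-1 = stair t.
Proof. by rewrite /stair ltnn ifT; lia. Qed.

(** The two leading terms cancel, or [y * lead i] is the corner [lead t]; a tail monomial multiplied
    by [x] or [y] enters the ideal only at a corner. *)
Lemma jsupp_syz H i : marked r t H -> (i <= r)%N -> jsupp corner (syz t H i).
Proof.
move=> hH hi z a b hz hab nz; apply: contraT => nc.
have hi1 : (i <= r.+1)%N by lia.
have hyM := jsupp_yM (hH i hi1); have hxM := jsupp_xM (hH i.+1 hi).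
have [/andP[/eqP ea /eqP eb]|hn] := boolP ((a == stair i) && (b == i.+1)).
  case/negP: nz; rewrite mcoeff_syz // ea eb.
  have [eit|nit] := eqVneq i.+1 t.
    case/negP: nc; rewrite /corner ea eb ltnS hi andbT eit -stair_pivot -eit.
    by rewrite eqxx.
  rewrite mulr1n (stairS hi nit).
  have h1 := (hH i hi1 z (stair i.+1).+1 i hz).2.
  rewrite h1; last by rewrite (stairS hi nit).
  by rewrite (hH i.+1 hi z (stair i.+1) i.+1 hz).2 // (stairS hi nit) !eqxx subrr.
case/negP: nz; rewrite /syz mcoeffB mcoeffMn.
have -> : ('X_(iy q) * H i)@_(mono z a b) = 0.
  apply/eqP; apply: contraNT hn => nz.
  by have := hyM z a b hz hab nz; rewrite (negbTE nc).
rewrite sub0r oppr_eq0; have [_|nit] := eqVneq i.+1 t; first by rewrite mulr0n.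
rewrite mulr1n; apply: contraNT hn => nz.
by have := hxM z a b hz hab nz; rewrite (negbTE nc) -stairS.
Qed.

Lemma corner_next j : (j <= r.+1)%N -> j != t.-1 ->
  corner (stair j) j.+1 = false.
Proof.
move=> hj hjt; rewrite /corner; apply/negP => /andP[/eqP h1 h2].
by move: h1; rewrite /stair; case: (ltnP j t); case: (ltnP j.+1 t); lia.
Qed.

(** For [i] other than [t.-1] and [t], the z-multiples of [y * lead i] are not corners, so neither
    [p] nor the right-hand side contains them, and among the [y H_j] only [y H_i] does. *)
Lemma next_coef_eq0 H (a d : nat -> S) p : marked r t H -> jsupp corner p ->
  (forall j, zonly (a j)) -> (forall j, zonly (d j)) ->
  p + \sum_(j < r.+2 | (j != t.-1 :> nat) && (j != t :> nat))
        d j * ('X_(iy q) * H j) = \sum_(j < r.+2) a j * H j ->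
  forall i, (i <= r.+1)%N -> i != t.-1 -> i != t -> d i = 0.
Proof.
move=> hH hp ha hd E i hi hit1 hit; apply/mpolyP => z; rewrite mcoeff0.
have [hz|/hd//] := boolP (zmon z).
have hJ : (stair i.+1 <= stair i)%N by rewrite stair_anti.
have := congr1 (mcoeff (mono z (stair i) i.+1)) E.
have nc := corner_next hi hit1.
rewrite (mcoeff_zsum ht ha hH hz hJ) -/(corner _ _) nc mulr0n mcoeffD.
have -> : p@_(mono z (stair i) i.+1) = 0.
  by apply/eqP; apply: contraFT nc; exact: hp.
rewrite add0r raddf_sum (bigD1 (Ordinal (hi : (i < r.+2)%N))) /=; last by rewrite hit1 hit.
have ec (j : 'I_r.+2) : (d j * ('X_(iy q) * H j))@_(mono z (stair i) i.+1)
    = (d j)@_z *+ ((stair i == stair j) && (i == j)).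
  rewrite mulrCA mcoeff_yM //; apply: mcoeff_zonlyM => //.
  by apply: hH; rewrite -ltnS.
have /= -> := ec (Ordinal (hi : (i < r.+2)%N)).
rewrite !eqxx mulr1n big1 => [|j /andP[_ /eqP hj]]; first by rewrite addr0.
rewrite ec (_ : (i == j) = false) ?andbF ?mulr0n //.
by apply/eqP => e'; apply: hj; exact: val_inj.
Qed.

Lemma mul_split (I : finType) (P : pred I) (x y h h' h'' : S) (u v : I -> S) :
  y * h = h' + \sum_(i | P i) u i * v i ->
  y * (y * h) - x * h'' = y * h' - x * h'' + \sum_(i | P i) u i * (y * v i).
Proof.
move=> ->; rewrite mulrDr mulr_sumr addrAC; congr (_ + _).
by apply: eq_bigr => i _; exact: mulrCA.
Qed.

End OneRing.

(** * Relations over a ring in which the equations of the stratum hold *)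

Section Reductions.

Variable k : fieldType.
Local Notation G := (Rgens q.+1 r t).
Local Notation prec := (@revlex q.+2).
Local Notation C := {mpoly k[nparam prec G]}.
Local Notation F := (@marked_family k _ prec G).
Local Notation fam := (@stratum_family q r t ht k).
Variables (L : comNzRingType) (f : {rmorphism C -> L}).
Local Notation S := {mpoly L[q.+2]}.
Local Notation mapf := (map_mpoly f).

Lemma family_premarked : premarked r t fam.
Proof.
move=> j hj hjt z a b hz.
pose i := @gen q r t ht (unbump t j).
have ei : bump t i = j.
  rewrite val_gen; last by move: hj hjt; rewrite /unbump; case: ltnP; lia.
  by rewrite unbumpKcond (negbTE hjt) add0n.
have em : mingen i = mono 0 (stair j) j by rewrite mingenE // ei.
have et := tailE ht i (mono z a b); rewrite ei mdeg_mono addnA in et.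
rewrite /inJ mono_x ?mono_y // in et.
split=> hd; rewrite /stratum_family -/i mcoeff_marked_notin // ?et ?negb_and ?hd ?orbT // em.
  case: eqP => // e'; case/negP: hd; apply/eqP.
  by move/(congr1 (@mdeg _)): e'; rewrite !mdeg_mono addnA mdeg0 add0n stairD // => ->.
by rewrite mono_eq ?zmon0.
Qed.

(** The choices made in a reduction are unknown. The support bound [P] restricts the multiplier at
    each step, so membership in [D] need only be checked for these multiples. *)
Lemma red_step_inv (P : nat -> nat -> bool) (D : S -> Prop) :
  D 0 -> (forall p p', D p -> D p' -> D (p + p')) ->
  (forall a p, D p -> D (a *: p)) ->
  (forall c (l : gen_index G),
     P ((c + mingen l)%MM (ix q)) ((c + mingen l)%MM (iy q)) ->
     D (mapf ('X_[c] * F l)) /\ jsupp P ('X_[c] * F l)) ->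
  forall p h : {mpoly C[q.+2]}, clos_refl_trans _ (@red_step k _ prec G) p h ->
  jsupp P p -> jsupp P h /\ D (mapf (p - h)).
Proof.
move=> D0 DD DZ hP p h; elim=> {p h} [p h [l [c [nz ->]]]|p|p1 p2 p3 _ IH1 _ IH2] hp.
- have hJ : (stair ((c + mingen l)%MM (iy q)) <= (c + mingen l)%MM (ix q))%N.
    have : in_monideal G (c + mingen l)%MM.
      have sub : {subset mingens G <= G} by move=> a; rewrite mingensE.
      by apply/hasP; exists (mingen l); rewrite ?lem_addl //; apply: sub; exact: mem_tnth.
    by rewrite in_monidealE.
  have := hp _ _ _ (zmon_zpart (c + mingen l)%MM) hJ; rewrite monoK => /(_ nz) hPl.
  have [hD hj] := hP _ _ hPl; split.
    by apply: jsuppD => //; apply/jsuppN; rewrite -scalerAl; exact: jsuppZ.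
  by rewrite opprB addrC subrK -scalerAl map_mpolyZ; exact: DZ.
- by split=> //; rewrite subrr rmorph0.
have [h2 d2] := IH1 hp; have [h3 d3] := IH2 h2; split=> //.
by rewrite -(subrK p2 p1) -addrA rmorphD; apply: DD.
Qed.

Local Notation H := (extend r t fam).
Local Notation HL := (extend r t (fun j => mapf (fam j))).

Lemma extended_family_marked : marked r t H.
Proof. exact: extend_marked family_premarked. Qed.

Lemma map_family_premarked : premarked r t (fun j => mapf (fam j)).
Proof. by move=> j hj hjt; apply: map_markedj; exact: family_premarked. Qed.

Lemma mapped_family_marked : marked r t HL.
Proof. exact: extend_marked map_family_premarked. Qed.

Lemma map_extended_family j : mapf (H j) = HL j.
Proof. exact: map_extend. Qed.

Definition zspan (p : S) := exists2 a : nat -> S,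
  forall j, zonly (a j) & p = \sum_(j < r.+2) a j * HL j.

Lemma zspan0 : zspan 0.
Proof.
exists (fun=> 0) => [j|]; first exact: zonly0.
by rewrite big1 // => j _; rewrite mul0r.
Qed.

Lemma zspanD p p' : zspan p -> zspan p' -> zspan (p + p').
Proof.
move=> [a ha ->] [a' ha' ->]; exists (fun j => a j + a' j) => [j|]; first exact: zonlyD.
by rewrite -big_split; apply: eq_bigr => j _; rewrite mulrDl.
Qed.

Lemma zspanZ c p : zspan p -> zspan (c *: p).
Proof.
move=> [a ha ->]; exists (fun j => c *: a j) => [j|]; first exact: zonlyZ.
by rewrite scaler_sumr; apply: eq_bigr => j _; rewrite scalerAl.
Qed.

Lemma zspan_zX g p : zmon g -> zspan p -> zspan ('X_[g] * p).
Proof.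
move=> hg [a ha ->]; exists (fun j => 'X_[g] * a j) => [j|]; first exact: zonlyXM.
by rewrite mulr_sumr; apply: eq_bigr => j _; rewrite mulrA.
Qed.

Lemma zspan_zonly p p' : zonly p -> zspan p' -> zspan (p * p').
Proof.
move=> hp hp'; rewrite [p]mpolyE mulr_suml; elim/big_ind: _ => [||m _].
- exact: zspan0.
- exact: zspanD.
rewrite -scalerAl; have [hm|/hp->] := boolP (zmon m); first exact/zspanZ/zspan_zX.
by rewrite scale0r; exact: zspan0.
Qed.

Lemma zspan_entry j : (j <= r.+1)%N -> zspan (HL j).
Proof.
move=> hj; exists (fun i => (i == j)%:R) => [i|].
  case: (i == j); last exact: zonly0.
  by rewrite -mpolyX0; apply: zonlyX; exact: zmon0.
rewrite (bigD1 (Ordinal (hj : (j < r.+2)%N))) //= eqxx mul1r big1 ?addr0 // => i /eqP hi.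
rewrite (_ : (i == j :> nat) = false) ?mul0r //.
by apply/eqP => e'; apply: hi; exact: val_inj.
Qed.

Lemma zspan_syz_pivot : zspan ('X_(iy q) * HL t.-1).
Proof.
have [a ha E] := syz_extend ht map_family_premarked.
exists a => //; rewrite -E /syz prednK ?eqxx ?mulr0n ?subr0 //; lia.
Qed.

Lemma marked_familyE (l : gen_index G) : F l = H (bump t l).
Proof. by rewrite extendN ?neq_bump_t // (stratum_family_bump ht). Qed.

(** The staircase descends strictly except from [t.-1] to [t]. A corner divided by a generator
    therefore leaves a monomial in the z's, or [y] times one when the generator is [lead t.-1]. *)
Lemma corner_step c (l : gen_index G) :
  corner ((c + mingen l)%MM (ix q)) ((c + mingen l)%MM (iy q)) ->
  zspan (mapf ('X_[c] * F l)) /\ jsupp corner ('X_[c] * F l).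
Proof.
have hl := bump_le ht (gen_le ht l); set j := bump t l in hl *.
rewrite !mnmDE mingenE // -/j mono_x ?mono_y ?zmon0 // => /andP[/eqP hx hy].
have njt : j != t by exact: neq_bump_t.
have hm := extended_family_marked hl.
have [cx [cy|[cy ej]]] : c (ix q) = 0%N /\ (c (iy q) = 0%N \/ (c (iy q) = 1%N /\ j = t.-1)).
  by move: hx; rewrite /stair; case: (ltnP j t); case: (ltnP (c (iy q) + j) t); lia.
- have hc : zmon c by rewrite /zmon cx cy.
  rewrite marked_familyE -/j; split; last exact/jsupp_zX/jsupp_markedj.
  by rewrite rmorphM /= map_mpolyX map_extended_family; apply/zspan_zX/zspan_entry.
have hle : (U_(iy q) <= c)%MM by rewrite lep1mP cy.
have hc : zmon (c - U_(iy q))%MM by rewrite /zmon !mnmBE !mnm1E cx cy.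
rewrite -(submK hle) mpolyXD -mulrA marked_familyE -/j; split.
  rewrite rmorphM /= map_mpolyX; apply: zspan_zX => //.
  by rewrite rmorphM /= map_mpolyX map_extended_family ej; exact: zspan_syz_pivot.
apply: jsupp_zX => //; apply: jsuppS (jsupp_yM hm) => a b.
case/orP => // /andP[/eqP-> /eqP->]; rewrite /corner ej prednK; last by lia.
by rewrite stair_pivot eqxx /=; lia.
Qed.

Hypothesis hred : forall i j : gen_index G, (i < j)%N ->
  exists2 h, complete_reduction (Spoly k prec i j) h & forall m, f h@_m = 0.

Lemma map_red_eq0 (h : {mpoly C[q.+2]}) : (forall m, f h@_m = 0) -> mapf h = 0.
Proof. by move=> hm; apply/mpolyP => m; rewrite mcoeff_map_mpoly mcoeff0; exact: hm. Qed.

Lemma Spoly_lead (i j : gen_index G) : (i < j)%N ->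
  Spoly k prec i j =
  'X_[U_(iy q) *+ (bump t j - bump t i)] * F i -
  'X_[U_(ix q) *+ (stair (bump t i) - stair (bump t j))] * F j.
Proof.
move=> hij; rewrite /Spoly (mingenE ht i) (mingenE ht j).
set a := bump t i; set b := bump t j.
have hab : (a <= b)%N by rewrite leq_bump2 ltnW.
have hs := stair_anti ht hab.
have E c : lead q r t c = mono 0 (stair c) c by [].
have -> : (mlcm (lead q r t a) (lead q r t b) - lead q r t a)%MM =
    (U_(iy q) *+ (b - a))%MM.
  apply/mnmP => l; rewrite !E mnmBE mnmE mulmnE mnm1E.
  case: (ixP l) => [->|->|hl]; rewrite ?mono_x ?mono_y ?zmon0 //=; [|lia|].
    by rewrite (maxn_idPl hs) subnn.
  by rewrite !monoE ge2_ix // ge2_iy // mnm0E.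
have -> : (mlcm (lead q r t a) (lead q r t b) - lead q r t b)%MM =
    (U_(ix q) *+ (stair a - stair b))%MM.
  apply/mnmP => l; rewrite !E mnmBE mnmE mulmnE mnm1E.
  case: (ixP l) => [->|->|hl]; rewrite ?mono_x ?mono_y ?zmon0 //=; [lia| |].
    by rewrite (maxn_idPr hab) subnn.
  by rewrite !monoE ge2_ix // ge2_iy // mnm0E.
reflexivity.
Qed.

(** Away from [t] the rows [j] and [j.+1] are adjacent generators whose S-polynomial is [syz]
    itself; its reduction becomes 0 in [L]. *)
Lemma zspan_syz j : (j <= r)%N -> j != t.-1 -> j != t -> zspan (syz t HL j).
Proof.
move=> hj hjt1 hjt; pose i := unbump t j.
have eb : bump t i = j by rewrite unbumpKcond (negbTE hjt).
have hi : (i < r)%N by move: hj hjt; rewrite /i /unbump; case: ltnP; lia.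
have eb1 : bump t i.+1 = j.+1.
  by move: hjt1; rewrite -eb /bump; case: (leqP t i); case: (leqP t i.+1); lia.
pose gi := @gen q r t ht i; pose gj := @gen q r t ht i.+1.
have vi : gi = i :> nat by rewrite val_gen // ltnW.
have vj : gj = i.+1 :> nat by rewrite val_gen.
have hij : (gi < gj)%N by rewrite vi vj.
have [h [hr _] h0] := hred hij.
have hS : Spoly k prec gi gj = syz t H j.
  have nS : j.+1 != t by lia.
  rewrite (Spoly_lead hij) (marked_familyE gi) (marked_familyE gj) vi vj eb eb1.
  rewrite /syz nS subSnn (stairS hj nS) subSnn.
  by rewrite !mulm1n mulr1n.
rewrite hS in hr.
have [_] := red_step_inv zspan0 zspanD zspanZ corner_step hr (jsupp_syz extended_family_marked hj).
rewrite rmorphB /= (map_red_eq0 h0) subr0 map_syz.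
by move=> hz; rewrite (_ : syz t HL j = syz t (fun j => mapf (H j)) j) // /syz !map_extended_family.
Qed.

Lemma zspanN p : zspan p -> zspan (- p).
Proof. by rewrite -scaleN1r; exact: zspanZ. Qed.

(* The S-polynomial for [lead t.-1] and [lead t.+1] involves [y ^ 2 H_(t.-1)],
   so that its reduction also uses multiples [y H_j]. *)
Definition yspan (p : S) := exists2 b : nat -> S, forall j, zonly (b j) &
  zspan (p - \sum_(j < r.+2 | (j != t.-1 :> nat) && (j != t :> nat))
                b j * ('X_(iy q) * HL j)).

Lemma yspan0 : yspan 0.
Proof.
exists (fun=> 0) => [j|]; first exact: zonly0.
by rewrite big1 ?subr0 => [|j _]; [exact: zspan0 | rewrite mul0r].
Qed.

Lemma yspanD p p' : yspan p -> yspan p' -> yspan (p + p').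
Proof.
move=> [b hb h] [b' hb' h']; exists (fun j => b j + b' j) => [j|]; first exact: zonlyD.
under eq_bigr do rewrite mulrDl.
by rewrite big_split /= opprD addrACA; exact: zspanD.
Qed.

Lemma yspanZ c p : yspan p -> yspan (c *: p).
Proof.
move=> [b hb h]; exists (fun j => c *: b j) => [j|]; first exact: zonlyZ.
under eq_bigr do rewrite -scalerAl.
by rewrite -scaler_sumr -scalerBr; exact: zspanZ.
Qed.

Lemma yspan_zspan p : zspan p -> yspan p.
Proof.
move=> hp; exists (fun=> 0) => [j|]; first exact: zonly0.
by rewrite big1 ?subr0 // => j _; rewrite mul0r.
Qed.

Lemma yspan_yM p j : (j <= r.+1)%N -> j != t.-1 -> j != t -> zonly p ->
  yspan (p * ('X_(iy q) * HL j)).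
Proof.
move=> hj hjt1 hjt hp; exists (fun i => if i == j then p else 0) => [i|].
  by case: ifP => _ //; exact: zonly0.
have hj2 : (j < r.+2)%N by [].
rewrite (bigD1 (Ordinal hj2)) /=; last by rewrite hjt1 hjt.
rewrite eqxx big1 ?addr0 ?subrr => [|i /andP[_ /eqP hi]]; first exact: zspan0.
rewrite (_ : (i == j :> nat) = false) ?mul0r //.
by apply/eqP => e'; apply: hi; exact: val_inj.
Qed.

(** The new multiples are z-multiples of [y F_j], kept as they are, or of [x F_j]. The latter are
    turned into multiples of [y H_(j-1)] by the relation of row [j.-1], already available from
    [zspan_syz]. *)
Lemma next_corner_step c (l : gen_index G) :
  let a := (c + mingen l)%MM (ix q) in let b := (c + mingen l)%MM (iy q) in
  corner a b || next_corner a b ->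
  yspan (mapf ('X_[c] * F l)) /\
  jsupp (fun a b => corner a b || next_corner a b) ('X_[c] * F l).
Proof.
move=> a0 b0 /orP[hc|].
  have [h1 h2] := corner_step hc; split; first exact: yspan_zspan.
  by apply: jsuppS h2 => a b ->.
rewrite {}/a0 {}/b0.
have hl := bump_le ht (gen_le ht l); set j := bump t l in hl *.
rewrite !mnmDE mingenE // -/j mono_x ?mono_y ?zmon0 // => /and5P[h1 /eqP h2 h3 h4 h5].
have njt : j != t by exact: neq_bump_t.
have hm := extended_family_marked hl.
have [e1|[hj0 e1]] :
    (c (ix q) = 0%N /\ c (iy q) = 1%N) \/
    (((c (iy q) + j).-1 <= r)%N /\
     (c (ix q) = 1%N /\ c (iy q) = 0%N)).
  move: h1 h2 h3 h4 h5; rewrite /stair.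
  by case: (ltnP j t); case: (ltnP (c (iy q) + j).-1 t); lia.
- case: e1 => cx cy; have hle : (U_(iy q) <= c)%MM by rewrite lep1mP cy.
  have hc : zmon (c - U_(iy q))%MM by rewrite /zmon !mnmBE !mnm1E cx cy.
  rewrite cy add1n /= in h4 h5.
  rewrite -(submK hle) mpolyXD -mulrA marked_familyE -/j; split.
    rewrite !rmorphM /= !map_mpolyX map_extended_family; apply: yspan_yM => //.
    exact: zonlyX.
  apply: jsupp_zX => //; apply: jsuppS (jsupp_yM hm) => a b /orP[->//|].
  move=> /andP[/eqP-> /eqP->]; apply/orP; right; rewrite /next_corner /=.
  by rewrite eqxx hl h4 h5.
case: e1 => cx cy; have hle : (U_(ix q) <= c)%MM by rewrite lep1mP cx.
have hc : zmon (c - U_(ix q))%MM by rewrite /zmon !mnmBE !mnm1E cx cy.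
rewrite cy add0n in h1 h2 h3 h4 h5 hj0.
have ej : j = j.-1.+1 by rewrite prednK.
have nS : j.-1.+1 != t by rewrite -ej.
rewrite -(submK hle) mpolyXD -mulrA marked_familyE -/j; split.
  rewrite !rmorphM /= !map_mpolyX map_extended_family.
  have -> : 'X_(ix q) * HL j = 'X_(iy q) * HL j.-1 - syz t HL j.-1.
    by rewrite /syz nS mulr1n -ej opprB addrCA subrr addr0.
  rewrite mulrBr; apply: yspanD; first by apply: yspan_yM => //; exact: zonlyX.
  by apply/yspan_zspan/zspanN/zspan_zX => //; exact: zspan_syz.
apply: jsupp_zX => //; apply: jsuppS (jsupp_xM hm) => a b /orP[->//|].
move=> /andP[/eqP-> /eqP->]; apply/orP; right; rewrite /next_corner.
by rewrite h1 h3 h4 h5 (stairS hj0 nS) -ej eqxx.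
Qed.

(** The S-polynomial of [lead t.-1] and [lead t.+1] is [syz] at [t] plus a combination of the
    [y H_i], by the definition of [H t]. Its reduction leaves multiples of [y H_i] with unknown
    coefficients; comparing supports shows that they cancel. *)
Lemma zspan_syz_t : (t <= r)%N -> zspan (syz t HL t).
Proof.
move=> htr; pose gi := @gen q r t ht t.-1; pose gj := @gen q r t ht t.
have vi : gi = t.-1 :> nat by rewrite val_gen //; lia.
have vj : gj = t :> nat by rewrite val_gen.
have hij : (gi < gj)%N by rewrite vi vj; lia.
have [h [hr _] h0] := hred hij.
have bi : bump t gi = t.-1 by rewrite vi /bump (_ : (t <= t.-1)%N = false); lia.
have bj : bump t gj = t.+1 by rewrite vj /bump leqnn.
have tp : t.-1.+1 = t by lia.
have eH : 'X_(iy q) * H t.-1 =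
    H t + \sum_(i < r.+2 | i != t :> nat) zpoly (ext_coef r t fam i) * H i.
  rewrite [H t]/extend eqxx extendN; last by lia.
  rewrite [X in _ - _ + X](eq_bigr (fun i : 'I_r.+2 => zpoly (ext_coef r t fam i) * fam i)).
    by rewrite subrK.
  by move=> i hi; rewrite extendN.
have hS : Spoly k prec gi gj = syz t H t +
    \sum_(i < r.+2 | i != t :> nat)
      zpoly (ext_coef r t fam i) * ('X_(iy q) * H i).
  rewrite (Spoly_lead hij) (marked_familyE gi) (marked_familyE gj) bi bj /syz.
  have -> : (t.+1 - t.-1 = 2)%N by lia.
  have -> : (stair t.-1 - stair t.+1 = 1)%N.
    by rewrite stair_pivot (stairS htr) ?subSnn //; lia.
  rewrite mulmS mulm1n mpolyXD mulm1n -mulrA.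
  rewrite (_ : t.+1 != t) ?mulr1n; last by lia.
  exact: mul_split eH.
have hsupp : jsupp (fun a b => corner a b || next_corner a b) (Spoly k prec gi gj).
  rewrite hS; apply: jsuppD.
    by apply: jsuppS (jsupp_syz extended_family_marked htr) => a b ->.
  apply: jsupp_sum => i hi; apply: jsupp_zonly; first exact: ext_coef_zonly.
  have hir : (i <= r.+1)%N by rewrite -ltnS.
  apply: jsuppS (jsupp_yM (extended_family_marked hir)) => a b /orP[->//|/andP[/eqP-> /eqP->]].
  have [ei|ni] := eqVneq (i : nat) t.-1.
    by rewrite /corner ei tp stair_pivot eqxx /=; apply/orP; left; lia.
  by rewrite /next_corner /= eqxx hir ni hi orbT.
have [_] := red_step_inv yspan0 yspanD yspanZ next_corner_step hr hsupp.
rewrite rmorphB /= (map_red_eq0 h0) subr0 hS rmorphD rmorph_sum /= map_syz.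
have -> : syz t (fun j => mapf (H j)) t = syz t HL t by rewrite /syz !map_extended_family.
have em (i : 'I_r.+2) : mapf (zpoly (ext_coef r t fam i) * ('X_(iy q) * H i)) =
    zpoly (fun g => f (ext_coef r t fam i g)) * ('X_(iy q) * HL i).
  by rewrite !rmorphM /= map_zpoly map_mpolyX map_extended_family.
rewrite (eq_bigr _ (fun i _ => em i)) => -[b hb].
set u := fun i : nat => zpoly (fun g => f (ext_coef r t fam i g)).
have hu i : zonly (u i).
  apply: zonly_zpoly => g hg; rewrite /ext_coef (negbTE hg); exact: rmorph0.
have htp2 : (t.-1 < r.+2)%N by lia.
(* The term of [t.-1] is set apart because [y HL_(t-1)] already lies in the span. *)
rewrite (bigD1 (Ordinal htp2)) /=; last by lia.
rewrite [X in _ + (_ + X) - _](eq_bigl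
  (fun i : 'I_r.+2 => (i != t.-1 :> nat) && (i != t :> nat))); last first.
  by move=> i; rewrite andbC.
rewrite [_ + (_ + _)]addrCA -addrA -addrA -sumrB => hsp.
have {hsp} : zspan (syz t HL t + \sum_(i < r.+2 | (i != t.-1 :> nat) && (i != t :> nat))
    (u i - b i) * ('X_(iy q) * HL i)).
  have := zspanD hsp (zspanN (zspan_zonly (hu t.-1) zspan_syz_pivot)).
  rewrite addrAC subrr add0r; congr (zspan (_ + _)).
  by apply: eq_bigr => i _; rewrite mulrBl.
move=> [a ha E].
have hD i : zonly (u i - b i) by apply: zonlyD => //; exact: zonlyN.
have D0 := next_coef_eq0 mapped_family_marked (jsupp_syz mapped_family_marked htr) ha hD E.
exists a => //; rewrite -E big1 ?addr0 // => i /andP[h1 h2].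
by rewrite D0 ?mul0r // -ltnS.
Qed.

Lemma stratum_syzrel :
  syzrel r t (syzmx r t (topcoef r HL) (syzcoef r t HL)) HL.
Proof.
apply: syzrel_of_span => //; first exact: mapped_family_marked.
move=> i hi; have [->|hit1] := eqVneq i t.-1.
  exact: syz_extend map_family_premarked.
have [eit|hit] := eqVneq i t; last exact: zspan_syz.
by rewrite eit; apply: zspan_syz_t; rewrite -eit.
Qed.

End Reductions.

End Support.

(** * Quotient by an ideal *)

Section IdealQuotient.

Variables (R : comNzRingType) (gens : R -> Prop).

Lemma in_ideal0 : in_ideal gens 0.
Proof. by exists [::]; rewrite ?big_nil. Qed.

Lemma in_idealD p p' : in_ideal gens p -> in_ideal gens p' -> in_ideal gens (p + p').
Proof.
move=> [s hs ->] [s' hs' ->]; exists (s ++ s'); last by rewrite big_cat.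
by move=> u; rewrite mem_cat => /orP[/hs|/hs'].
Qed.

Lemma in_idealM a p : in_ideal gens p -> in_ideal gens (a * p).
Proof.
move=> [s hs ->]; exists [seq (a * u.1, u.2) | u <- s].
  by move=> _ /mapP[u hu ->]; exact: hs hu.
by rewrite big_map mulr_sumr; apply: eq_bigr => u _; rewrite mulrA.
Qed.

Lemma in_ideal_gen p : gens p -> in_ideal gens p.
Proof.
move=> hp; exists [:: (1, p)]; first by move=> u; rewrite mem_seq1 => /eqP->.
by rewrite big_seq1 mul1r.
Qed.

Hypothesis proper : ~ in_ideal gens 1.

(** The quotient construction takes a boolean predicate, so membership is decided classically. *)
Definition idealb : {pred R} :=
  fun p => if excluded_middle_informative (in_ideal gens p) then true else false.

Lemma idealbP p : reflect (in_ideal gens p) (p \in idealb).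
Proof.
rewrite unfold_in /idealb.
by case: excluded_middle_informative => h; constructor.
Qed.

Lemma idealb_closed : idealr_closed idealb.
Proof.
split; first exact/idealbP/in_ideal0.
  by apply/idealbP.
move=> a p p' /idealbP hp /idealbP hp'; apply/idealbP/in_idealD => //.
exact: in_idealM.
Qed.

HB.instance Definition _ := isIdealr.Build R idealb idealb_closed.

Lemma quotient_ring : exists (Q : comNzRingType) (f : {rmorphism R -> Q}),
  forall p, f p = 0 <-> in_ideal gens p.
Proof.
exists {ideal_quot idealb}, (\pi_({ideal_quot idealb}))%qT => p; split=> hp.
  apply/idealbP; rewrite -[p]subr0 Quotient.idealrBE; apply/eqP.
  by rewrite hp (rmorph0 (\pi_({ideal_quot idealb}))%qT).
rewrite -(rmorph0 (\pi_({ideal_quot idealb}))%qT); apply/eqP.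
by rewrite -Quotient.idealrBE subr0; apply/idealbP.
Qed.

End IdealQuotient.

(** * Counting the parameters *)

Local Close Scope ring_scope.

Section Counting.

Variable q : nat.

Definition zembed (m : 'X_{1..q.+1}) : 'X_{1..q.+3} :=
  [multinom (if i < 2 then 0 else m (inord (i - 2))) | i < q.+3].

Lemma zembed_inj : injective zembed.
Proof.
move=> m m' e; apply/mnmP => i.
have hi : i.+2 < q.+3 by rewrite !ltnS; exact: (ltn_ord i).
have := congr1 (fun m => fun_of_multinom m (Ordinal hi)) e.
by rewrite !mnmE /= subn2 /= inord_val.
Qed.

Lemma zmon_zembed m : zmon (zembed m).
Proof. by rewrite /zmon !mnmE. Qed.

Lemma mdeg_zembed m : mdeg (zembed m) = mdeg m.
Proof.
rewrite !mdegE 2!big_ord_recl !mnmE /= !add0n; apply: eq_bigr => i _.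
by rewrite mnmE /= /bump !add1n subn2 /= inord_val.
Qed.

Lemma zmon_image z : zmon z -> exists m, z = zembed m.
Proof.
move=> /andP[/eqP zx /eqP zy].
exists [multinom z (inord i.+2) | i < q.+1]; apply/mnmP => i; rewrite !mnmE.
case: (ixP i) => [->|->|hi]; rewrite ?zx ?zy // ltnNge hi /=.
congr (z _); apply: val_inj; rewrite /= !inordK //; have := ltn_ord i; lia.
Qed.

Lemma card_zmon d : d < 3 ->
  #|[pred z : 'X_{1..q.+3 < 3} | zmon (bmnm z) && (mdeg (bmnm z) == d)]| =
  'C(d + q, d).
Proof.
move=> hd; rewrite -size_basis cardE -(size_map (@bmnm _ _)) -[RHS](size_map zembed).
apply/perm_size/uniq_perm.
- rewrite map_inj_uniq ?enum_uniq // => z z' e; apply/eqP; rewrite bmeqP; exact/eqP.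
- by rewrite map_inj_uniq ?uniq_basis //; exact: zembed_inj.
move=> z; apply/mapP/mapP => [[z']|[m hm ->]].
  rewrite mem_enum inE => /andP[hz hz'] ->; have [m e] := zmon_image hz.
  by exists m => //; rewrite -basis_cover -mdeg_zembed -e.
have hm3 : mdeg (zembed m) < 3.
  by move: hm; rewrite -basis_cover mdeg_zembed => /eqP->.
exists (BMultinom hm3) => //; rewrite mem_enum inE /= zmon_zembed mdeg_zembed.
by rewrite basis_cover.
Qed.

Variables r t : nat.
Hypothesis ht : 0 < t <= r.+1.

Definition syz_param :=
  {w : 'I_r.+1 * 'I_r.+2 * 'X_{1..q.+3 < 3} | free_index r t w.1.1 w.1.2 (bmnm w.2)}.

Definition param := ('I_t * 'I_(r.+1 - t) + syz_param)%type.

Lemma sum_threshold n m a b : m <= n ->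
  \sum_(i < n) (if i < m then a else b) = m * a + (n - m) * b.
Proof.
move=> hm; rewrite -(big_mkord xpredT (fun i => if i < m then a else b)).
rewrite (@big_cat_nat _ _ _ m) //=; congr (_ + _).
  rewrite big_nat (eq_bigr (fun=> a)) => [|i /andP[_ ->] //].
  by rewrite -big_nat sum_nat_const_nat subn0.
rewrite big_nat (eq_bigr (fun=> b)) => [|i /andP[h _]]; last by rewrite ltnNge h.
by rewrite -big_nat sum_nat_const_nat.
Qed.

Lemma card_syz_entry i j : i <= r -> j <= r.+1 ->
  \sum_(z : 'X_{1..q.+3 < 3} | free_index r t i j (bmnm z)) 1 =
  if i < t then (if i.+1 == t then 0 else if j < t then q.+1 else 0)
  else if j < t then 'C(q.+2, 2) else q.+1.
Proof.
move=> hi hj; rewrite sum1_card; set N := #|_|.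
have E d : d < 3 -> i.+1 != t -> (i < t) ==> (j < t) ->
    d + rowdeg r t j = (rowdeg r t i).+1 ->
    N = 'C(d + q, d).
  move=> hd h1 h2 h3; rewrite -card_zmon //; apply: eq_card => z.
  by rewrite /in_mem /= /free_index hi hj h1 h2 -h3 eqn_add2r.
have E0 : (i.+1 == t) || ~~ ((i < t) ==> (j < t)) ->
    N = 0.
  move=> h; apply: eq_card0 => z; rewrite /in_mem /= /free_index.
  by move: h; case: (i.+1 == t); case: (_ ==> _) => //=; rewrite ?andbF.
case: (ltnP i t) => hit.
  have [eit|nit] := eqVneq i.+1 t; first by rewrite E0 ?eit ?eqxx.
  case: (ltnP j t) => hjt; last by rewrite E0 // hit /= -leqNgt hjt orbT.
  by rewrite (E 1) // ?hit ?hjt // ?bin1 // /rowdeg hit hjt.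
have nit : i.+1 != t by lia.
case: (ltnP j t) => hjt.
  by rewrite (E 2) // ?(ltnNge i) ?hit // /rowdeg hjt ltnNge hit.
rewrite (E 1) // ?(ltnNge i) ?hit // ?bin1 // /rowdeg !ltnNge hit hjt //.
Qed.

Lemma card_syz_param :
  #|{: syz_param}| = t.-1 * (t * q.+1) +
     (r.+1 - t) * (t * 'C(q.+2, 2) + (r.+2 - t) * q.+1).
Proof.
rewrite card_sig -sum1_card big_mkcond /=.
rewrite -(pair_bigA _ (fun (w : 'I_r.+1 * 'I_r.+2) (z : 'X_{1..q.+3 < 3}) =>
  if free_index r t w.1 w.2 (bmnm z) then 1 else 0)) /=.
rewrite -(pair_bigA _ (fun (i : 'I_r.+1) (j : 'I_r.+2) => \sum_(z : 'X_{1..q.+3 < 3})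
  if free_index r t i j (bmnm z) then 1 else 0)) /=.
have E (i : 'I_r.+1) (j : 'I_r.+2) : \sum_(z : 'X_{1..q.+3 < 3})
    (if free_index r t i j (bmnm z) then 1 else 0) =
    if j < t then (if i < t then if i.+1 == t then 0 else q.+1 else 'C(q.+2, 2))
    else (if i < t then 0 else q.+1).
  have hi : i <= r by rewrite -ltnS.
  have hj : j <= r.+1 by rewrite -ltnS.
  rewrite -big_mkcond (card_syz_entry hi hj).
  by case: (i < t); case: (j < t); case: (i.+1 == t).
rewrite (eq_bigr _ (fun i _ => eq_bigr _ (fun j _ => E i j))).
rewrite (eq_bigr (fun i : 'I_r.+1 =>
    if i < t then (if i.+1 == t then 0 else t * q.+1)
    else t * 'C(q.+2, 2) + (r.+2 - t) * q.+1)); last first.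
  move=> i _; rewrite sum_threshold; last by lia.
  by case: (i < t) => //; case: (i.+1 == t); rewrite ?muln0 ?addn0.
case: t ht => // t' ht' /=.
rewrite (eq_bigr (fun i : 'I_r.+1 => (if i < t' then t'.+1 * q.+1 else 0) +
   (if i < t'.+1 then 0 else t'.+1 * 'C(q.+2, 2) + (r.+2 - t'.+1) * q.+1))).
  by rewrite big_split /= !sum_threshold ?muln0 ?addn0 //; lia.
move=> i _; rewrite eqSS.
case: (ltngtP i t') => h; first by rewrite (leqW h) addn0.
  by rewrite ltnS leqNgt h.
by rewrite h ltnSn.
Qed.

Lemma card_param mu : mu = (r + 2) * (r + 1) %/ 2 - t ->
  #|{: param}| = 2 * q.+1 * mu + t * (r + 1 - t) * 'C(q, 2).
Proof.
move=> hmu; rewrite card_sum card_prod !card_ord card_syz_param.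
(* Each of the [t * (r + 1 - t)] quadrics has [2 * q + 1] coefficients beyond ['C(q, 2)]; with one
   coefficient at a z-free monomial per quadric this becomes [2 * q.+1], which joins the multiple of
   [mu]. *)
have e2 n : 'C(n.+2, 2) = 'C(n, 2) + 2 * n + 1 by rewrite !binS bin0 bin1; lia.
rewrite e2; set c := 'C(q, 2).
have [s hs] : exists s, r.+1 = t + s by exists (r.+1 - t); lia.
have hr : (r + 2) * (r + 1) = (t + s).+1 * (t + s) by rewrite -hs; lia.
have := bin2 (t + s).+1; rewrite -divn2 /= => hT.
have hT2 : 2 * (((t + s).+1 * (t + s)) %/ 2) = (t + s).+1 * (t + s).
  by rewrite mulnC divnK // dvdn2 oddM oddS andNb.
have -> : r.+1 - t = s by lia.
have -> : r.+2 - t = s.+1 by lia.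
have -> : r + 1 - t = s by lia.
have [t' et] : exists t', t = t'.+1 by exists t.-1; lia.
have : 2 * mu + 2 * t = (t + s).+1 * (t + s).
  rewrite hmu hr -hT2; set T := _ %/ 2 in hT2 *; nia.
rewrite et /= => hm.
have -> : 2 * q.+1 * mu = q.+1 * (2 * mu) by lia.
have -> : 2 * mu = (t'.+1 + s).+1 * (t'.+1 + s) - 2 * t'.+1 by lia.
have -> : (t'.+1 + s).+1 * (t'.+1 + s) - 2 * t'.+1 =
    t' * t'.+1 + 2 * (t'.+1 * s) + s * s + s by lia.
lia.
Qed.

End Counting.

Local Open Scope ring_scope.

(** * The isomorphism *)

Lemma eq_rmorph_mpoly (n : nat) (R S : comNzRingType)
    (f g : {rmorphism {mpoly R[n]} -> S}) :
  (forall c, f c%:MP = g c%:MP) -> (forall i, f 'X_i = g 'X_i) -> f =1 g.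
Proof.
move=> hc hX p; rewrite [p]mpolyE !rmorph_sum; apply: eq_bigr => m _ /=.
rewrite -mul_mpolyC !rmorphM hc; congr (_ * _).
by rewrite mpolyXE_id !rmorph_prod; apply: eq_bigr => i _; rewrite !rmorphXn hX.
Qed.

Lemma eq_extend (q r t : nat) (K : comNzRingType) (F F' : nat -> {mpoly K[q.+2]}) :
  (0 < t <= r.+1)%N ->
  (forall j, (j <= r.+1)%N -> j != t -> F j = F' j) ->
  forall j, (j <= r.+1)%N -> extend r t F j = extend r t F' j.
Proof.
move=> ht h j hj; rewrite /extend; case: eqP => [_|/eqP hjt]; last exact: h.
have hp : F t.-1 = F' t.-1 by apply: h; lia.
rewrite hp; congr (_ - _); apply: eq_bigr => i hi.
have hir : (i <= r.+1)%N by rewrite -ltnS.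
rewrite (h i hir hi); congr (_ * _); apply: eq_bigr => g _.
by rewrite /ext_coef hp.
Qed.

Lemma eq_syzcoef (q r t : nat) (K : comNzRingType) (F F' : nat -> {mpoly K[q.+2]}) i j z :
  (forall j, (j <= r.+1)%N -> F j = F' j) -> (i <= r)%N ->
  syzcoef r t F i j z = syzcoef r t F' i j z.
Proof. by move=> h hi; rewrite /syzcoef /syz !h // leqW. Qed.

Section Main.

Variables (k : fieldType) (q r t : nat).
Hypothesis ht : (0 < t <= r.+1)%N.
Local Notation G := (Rgens q.+2 r t).
Local Notation prec := (@revlex q.+3).
Local Notation C := {mpoly k[nparam prec G]}.
Local Notation F := (@marked_family k _ prec G).
Local Notation fam := (@stratum_family q.+1 r t ht k).
Local Notation param := (param q r t).
Local Notation P := {mpoly k[#|{: param}|]}.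

(** [syzmx] takes families indexed by all natural numbers, hence the value 0 away from the positions
    of parameters. *)
Definition top_var i j : P :=
  if [pick w : 'I_t * 'I_(r.+1 - t) | (w.1 == i :> nat) && (t + w.2 == j)%N] is Some w
  then 'X_(enum_rank (inl w : param)) else 0.

Definition syz_var i j (z : 'X_{1..q.+3}) : P :=
  if [pick w : syz_param q r t | [&& (val w).1.1 == i :> nat, (val w).1.2 == j :> nat
        & bmnm (val w).2 == z]] is Some w
  then 'X_(enum_rank (inr w : param)) else 0.

Lemma top_varE (w : 'I_t * 'I_(r.+1 - t)) :
  top_var w.1 (t + w.2)%N = 'X_(enum_rank (inl w : param)).
Proof.
rewrite /top_var; case: pickP => [w' /andP[/eqP h1]|/(_ w)]; last by rewrite !eqxx.
rewrite eqn_add2l => /eqP h2; congr ('X_(enum_rank (inl _))).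
by case: w w' h1 h2 => [w1 w2] [w1' w2'] /= /val_inj-> /val_inj->.
Qed.

Lemma syz_varE (w : syz_param q r t) :
  syz_var (val w).1.1 (val w).1.2 (bmnm (val w).2) = 'X_(enum_rank (inr w : param)).
Proof.
rewrite /syz_var; case: pickP => [w' /and3P[/eqP h1 /eqP h2 /eqP h3]|/(_ w)];
  last by rewrite !eqxx.
congr ('X_(enum_rank (inr _))); apply: val_inj.
case: (val w) (val w') h1 h2 h3 => [[a b] z] [[a' b'] z'] /= /val_inj-> /val_inj-> h3.
by congr (_, _); apply/eqP; rewrite bmeqP h3.
Qed.

Local Notation u := (@sol q.+1 r t P syz_var top_var).

Definition to_param : {lrmorphism C -> P} :=
  comp_mpoly [tuple (u (bump t (val (enum_val l)).1))@_(bmnm (val (enum_val l)).2)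
             | l < nparam prec G].

Definition param_val (w : param) : C :=
  match w with
  | inl w => topcoef r (extend r t fam) w.1 (t + w.2)%N
  | inr w => syzcoef r t (extend r t fam) (val w).1.1 (val w).1.2 (bmnm (val w).2)
  end.

Definition of_param : {lrmorphism P -> C} :=
  comp_mpoly [tuple param_val (enum_val l) | l < #|{: param}|].

Lemma to_paramX (c : coef_index prec G) :
  to_param 'X_(enum_rank c) = (u (bump t (val c).1))@_(bmnm (val c).2).
Proof.
rewrite /to_param /= /comp_mpoly mmapX mmap1U tnth_mktuple enum_rankK.
reflexivity.
Qed.

Lemma of_paramX (w : param) : of_param 'X_(enum_rank w) = param_val w.
Proof. by rewrite /of_param /= /comp_mpoly mmapX mmap1U tnth_mktuple enum_rankK. Qed.

Lemma universal_marked : marked r t u.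
Proof. exact: sol_marked. Qed.

Lemma universal_syzrel : syzrel r t (syzmx r t top_var syz_var) u.
Proof. exact: sol_syzrel. Qed.

Lemma map_marked_family (i : gen_index G) :
  map_mpoly to_param (F i) = u (bump t i).
Proof.
have hb := bump_le ht (gen_le ht i).
apply/mpolyP => m; rewrite mcoeff_map_mpoly.
have [hm|hm] := boolP (tail prec i m).
  have [c [ei em]] := tail_coef_index ht hm.
  by rewrite -em -ei mcoeff_marked //; exact: to_paramX.
rewrite mcoeff_marked_notin //.
transitivity ((m == mingen i)%:R : P); first exact: rmorph_nat.
rewrite mingenE //.
have [h0 h1] := universal_marked hb (m (ix _)) (m (iy _)) (zmon_zpart m).
move: hm; rewrite tailE //; rewrite monoK in h0 h1.
have E : lead q.+1 r t (bump t i) = mono 0 (stair r t (bump t i)) (bump t i) by [].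
rewrite -[in mdeg m](monoK m) mdeg_mono addnA.
have [hd|hd] := eqVneq (mdeg (zpart m) + m (ix _) + m (iy _))%N (rowdeg r t (bump t i)).
  rewrite negbK => hJ; rewrite h1 // E -{1}(monoK m) mono_eq ?zmon_zpart ?zmon0 //.
move=> _; rewrite h0 //; case: eqP => // e'; case/eqP: hd.
have := congr1 (@mdeg _) e'.
by rewrite -{1}(monoK m) mdeg_mono addnA => ->; rewrite mdeg_lead.
Qed.

Lemma map_stratum_family j : (j <= r.+1)%N -> j != t -> map_mpoly to_param (fam j) = u j.
Proof.
move=> hj hjt; rewrite /stratum_family map_marked_family val_gen; last first.
  by move: hj hjt; rewrite /unbump; case: ltnP; lia.
by rewrite unbumpKcond (negbTE hjt).
Qed.

(** [extend] commutes with base change and fixes solutions, so agreement on the minimal generators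
    carries over to the entry at [t]. *)
Lemma map_extended_stratum_family j : (j <= r.+1)%N ->
  map_mpoly to_param (extend r t fam j) = u j.
Proof.
move=> hj; rewrite map_extend -[RHS](extend_id ht universal_marked universal_syzrel).
by apply: eq_extend => //; exact: map_stratum_family.
Qed.

Lemma topcoef_universal i j : (i < t)%N -> (t <= j <= r)%N -> topcoef r u i j = top_var i j.
Proof.
move=> hi /andP[hj hj']; rewrite /topcoef sol_leading //; last by lia.
rewrite /leading hi (_ : (r - j + j == r)%N); last by lia.
by rewrite /toprow ltnNge hj hj'.
Qed.

Lemma syzcoef_universal i j z : free_index r t i j z -> syzcoef r t u i j z = syz_var i j z.
Proof.
case/and5P => hi hj hit hij /andP[hz hd].
rewrite (syzcoef_syzrel ht universal_marked universal_syzrel) // /syzmx hz hd /= (negbTE hit).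
by case: (ltnP i t) hij => //= hi' hij; rewrite leqNgt hij.
Qed.

Lemma to_param_val (w : param) : to_param (param_val w) = 'X_(enum_rank w).
Proof.
case: w => w /=.
  have hi : (w.1 <= r.+1)%N by have := ltn_ord w.1; lia.
  rewrite map_topcoef /topcoef map_extended_stratum_family // -/(topcoef r u w.1 (t + w.2)%N).
  by rewrite topcoef_universal ?top_varE //; have := ltn_ord w.2; lia.
have hw := valP w; rewrite -syz_varE -(syzcoef_universal hw) map_syzcoef.
by case/and5P: hw => hi _ _ _ _; apply: eq_syzcoef => //; exact: map_extended_stratum_family.
Qed.

Lemma to_paramK p : to_param (of_param p) = p.
Proof.
apply: (@eq_rmorph_mpoly _ _ _ (to_param \o of_param)%FUN idfun) => [c|i] /=.
  by rewrite /comp_mpoly !mmapC.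
by rewrite -[i](enum_valK) of_paramX to_param_val.
Qed.

Variable H : gen_index G -> gen_index G -> {mpoly C[q.+3]}.
Hypothesis HH : Spoly_reductions H.
Local Notation V := (homogeneous_stratum H).

(** The S-polynomial and all that a reduction subtracts map to combinations of the universal
    solution. The remainder has no monomial in the ideal, hence maps to 0. *)
Lemma to_param_H (i j : gen_index G) b : (i < j)%N -> to_param (H i j)@_b = 0.
Proof.
move=> hij; have [hr hs] := HH hij.
pose ex := expandable r t u.
have exF c (l : gen_index G) : ex (map_mpoly to_param ('X_[c] * F l)).
  rewrite rmorphM /= map_mpolyX map_marked_family.
  by apply: (expandable_M ht universal_syzrel); exact: (bump_le ht (gen_le ht l)).
have ex0 : ex 0 by exact: expandable0.
have exD p p' : ex p -> ex p' -> ex (p + p') by exact: expandableD.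
have exZ a p : ex p -> ex (a *: p) by exact: expandableZ.
have [] := @red_step_inv q.+1 r t ht k P to_param (fun _ _ => true) ex ex0 exD exZ _
  _ _ hr (fun _ _ _ _ _ _ => isT).
  by move=> c l _; split=> // z a b' _ _ _.
move=> _ hex; rewrite -mcoeff_map_mpoly.
suff -> : map_mpoly to_param (H i j) = 0 by rewrite mcoeff0.
apply: (marked_basis_eq0 ht universal_marked).
  have E (a a' : {mpoly C[q.+3]}) : map_mpoly to_param a' =
      map_mpoly to_param a + (-1) *: map_mpoly to_param (a - a').
    by rewrite scaleN1r rmorphB opprB addrC subrK.
  rewrite (E (Spoly k prec i j)); apply: expandableD; last exact: exZ.
  rewrite /Spoly rmorphB; apply: expandableD; first exact: exF.
  by rewrite -scaleN1r; apply: expandableZ; exact: exF.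
move=> m hm; rewrite mcoeff_map_mpoly.
have [hms|/memN_msupp_eq0->] := boolP (m \in msupp (H i j)); last exact: rmorph0.
by have := hs m hms; rewrite in_monidealE // hm.
Qed.

Lemma to_param_ideal p : defining_ideal (V := V) p -> to_param p = 0.
Proof.
move=> [s hs ->]; rewrite rmorph_sum big_seq big1 // => w /hs [i [j [b [hij e]]]].
rewrite rmorphM e; transitivity (to_param w.1 * 0); last exact: mulr0.
by congr (_ * _); exact: to_param_H.
Qed.

(** In the quotient ring the marked family and the image of the universal solution satisfy the same
    relations with the same z-free coefficients, so uniqueness identifies them coefficient by
    coefficient. *)
Lemma of_paramK p : defining_ideal (V := V) (of_param (to_param p) - p).
Proof.
(* [to_param] kills the ideal but not 1, so the quotient is a nonzero ring. *)
have proper : ~ in_ideal (@equations k V) 1.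
  by move/to_param_ideal; rewrite rmorph1 => /eqP; rewrite oner_eq0.
have [Q [f hf]] := quotient_ring proper; apply/hf.
have hred (i j : gen_index G) : (i < j)%N ->
    exists2 h, complete_reduction (Spoly k prec i j) h & forall m, f h@_m = 0.
  move=> hij; exists (H i j); first exact: HH.
  by move=> m; apply/hf/in_ideal_gen; exists i, j, m.
pose HL := extend r t (fun j => map_mpoly f (fam j)).
have hHL : marked r t HL by exact: mapped_family_marked.
have hrel := stratum_syzrel ht hred.
pose fg : {rmorphism P -> Q} := (f \o of_param)%FUN.
pose u' j := map_mpoly fg (u j).
have hu' : marked r t u' by move=> j hj; apply: map_markedj; exact: (universal_marked hj).
have hrel' := map_syzrel fg universal_syzrel.
have htop i j : (i < t)%N -> (t <= j <= r)%N ->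
    topcoef r HL i j = fg (top_var i j).
  move=> hi hj; have hjr : (j - t < r.+1 - t)%N by lia.
  have := top_varE (Ordinal hi, Ordinal hjr) => /=; rewrite subnKC; last by lia.
  move=> ->; rewrite /fg /= of_paramX /= subnKC; last by lia.
  by rewrite map_topcoef /topcoef map_extend.
have hsyz i j z : free_index r t i j z -> syzcoef r t HL i j z = fg (syz_var i j z).
  move=> hf'; case/and5P: (hf') => hi hj _ _ /andP[_ hd].
  have hz : (mdeg z < 3)%N.
    by move: hd; rewrite /rowdeg; case: ifP; case: ifP; lia.
  have hi' : (i < r.+1)%N by []. have hj' : (j < r.+2)%N by [].
  pose w : syz_param q r t := exist
    (fun w : 'I_r.+1 * 'I_r.+2 * 'X_{1..q.+3 < 3} => free_index r t w.1.1 w.1.2 (bmnm w.2))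
    (Ordinal hi', Ordinal hj', BMultinom hz) hf'.
  have := syz_varE w => /= ->; rewrite /fg /= of_paramX /=.
  by rewrite map_syzcoef /syzcoef /syz !map_extend.
have hrel2 : syzrel r t (syzmx r t (fun i j => fg (top_var i j))
    (fun i j z => fg (syz_var i j z))) HL.
  move=> i hi; rewrite hrel //; apply: eq_bigr => j _; congr (_ * _).
  apply: eq_bigr => g _; congr (_ *: _); apply: (eq_syzmx ht) => //.
  by rewrite -ltnS.
have hu : forall j, (j <= r.+1)%N -> HL j = u' j.
  apply: (marked_syzrel_unique ht hHL hu' hrel2 hrel') => i j hi hj.
  by rewrite htop // -topcoef_universal // map_topcoef.
rewrite rmorphB; apply/eqP; rewrite subr_eq0; apply/eqP.
apply: (@eq_rmorph_mpoly _ _ _ (fg \o to_param)%FUN f) => [c|l] /=.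
  by rewrite /comp_mpoly !mmapC.
have [c ->] : exists c : coef_index prec G, l = enum_rank c.
  by exists (enum_val l); rewrite enum_valK.
have hb := bump_le ht (gen_le ht (val c).1).
rewrite to_paramX.
transitivity ((u' (bump t (val c).1))@_(bmnm (val c).2)).
  by rewrite mcoeff_map_mpoly.
rewrite -hu // /HL extendN ?neq_bump_t // mcoeff_map_mpoly.
by rewrite stratum_family_bump mcoeff_marked.
Qed.

Lemma stratum_isomorphic : isomorphic V (affine_space k #|{: param}|).
Proof.
exists to_param, of_param; split.
- move=> p /to_param_ideal ->; exact: in_ideal0.
- move=> p [s hs ->]; have -> : s = [::].
    by case: s hs => // w s /(_ w (mem_head _ _)).
  by rewrite big_nil rmorph0; exact: in_ideal0.
- exact: of_paramK.
by move=> p; rewrite to_paramK subrr; exact: in_ideal0.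
Qed.

End Main.

Local Close Scope ring_scope.

Theorem theorem6p1 (k : fieldType) (n mu r t : nat)
  (hn : 2 <= n) (hmu : 0 < mu)
  (ht : 1 <= t <= r + 1) (hrt : mu = (r + 2) * (r + 1) %/ 2 - t)
  (H : gen_index (Rgens n r t) -> gen_index (Rgens n r t) ->
       {mpoly {mpoly k[nparam (@revlex n.+1) (Rgens n r t)]}[n.+1]})
  (HH : Spoly_reductions H) :
  isomorphic (homogeneous_stratum H)
    (affine_space k (2 * (n - 1) * mu + t * (r + 1 - t) * 'C(n - 2, 2))).
Proof.
case: n hn H HH => [|[|q]] // _ H HH.
have ht' : 0 < t <= r.+1 by rewrite -[r.+1]addn1.
have -> : 2 * (q.+2 - 1) * mu + t * (r + 1 - t) * 'C(q.+2 - 2, 2) =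
    #|{: param q r t}|.
  by rewrite (card_param q ht' hrt) subn1 subn2.
exact: (stratum_isomorphic ht' HH).
Qed.
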